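(* Let $(W,S)$ be an irreducible Coxeter system of rank $n$ equipped with a bilinear form $B$ of signature $(n-1,1)$. Call a subset $\Delta_I\subset\Delta$ generating if $\widehat{Q}\cap \mathrm{span}(\Delta_I)\subset \mathrm{conv}(\widehat{\Delta})\cap \mathrm{span}(\Delta_I)$. For $\Delta_I\subset\Delta$ let $E_I\subset E$ be the set of accumulation points of the normalized roots of the parabolic subgroup $W_I$ associated with $\Delta_I$. Then: (i) if $\Delta_I$ is generating, then $E_I=\widehat{Q}\cap \mathrm{span}(\Delta_I)$; (ii) $E$ is the topological closure of the subset $F_0$ of $\widehat{Q}$ defined by $$F_0:=W\cdot\Big(\bigcup_{\Delta_I\subset\Delta,\ \Delta_I\text{ generating}}\widehat{Q}\cap \mathrm{span}(\Delta_I)\Big).$$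
   Context: Setting: $(W,S)$ is a Coxeter system of rank $n$, $S=\{s_1,\dots,s_n\}$, with relations $(s_is_j)^{m_{ij}}=1$, $m_{ii}=1$, $m_{ij}=m_{ji}\in\mathbb{Z}_{>1}\cup\{\infty\}$ for $i\ne j$; it is irreducible if its Coxeter graph is connected. $V=\mathbb{R}^n$ is a Euclidean space with orthonormal basis $\Delta=\{\alpha_1,\dots,\alpha_n\}$ (simple roots, $\alpha_i$ corresponding to $s_i$). $B$ is a symmetric bilinear form on $V$ (identified with its matrix in the basis $\Delta$) with $B(\alpha_i,\alpha_i)=1$, $B(\alpha_i,\alpha_j)=-\cos(\pi/m_{ij})$ if $m_{ij}<\infty$, and $B(\alpha_i,\alpha_j)$ any real number $\le -1$ if $m_{ij}=\infty$. $W$ acts linearly on $V$ with $s_i$ acting as $s_{\alpha_i}(v)=v-2B(\alpha_i,v)\alpha_i$. The root system is $\Phi=W(\Delta)$. For $\Delta_I\subset\Delta$, $W_I$ is the subgroup generated by the $s_\alpha$, $\alpha\in\Delta_I$, and its roots are the elements of $\Phi_I=W_I(\Delta_I)$. Normalization: since $B$ has signature $(n-1,1)$, let $o=\sum_i o_i\alpha_i$ be the eigenvector of Euclidean norm $1$ of the matrix $B$ for its negative eigenvalue with all $o_i>0$ (it exists). Put $|v|_1=\sum_i o_iv_i$ for $v=\sum_i v_i\alpha_i$, $V_0=\{v:|v|_1=0\}$, $V_1=\{v:|v|_1=1\}$, $\widehat{v}=v/|v|_1$ for $v\notin V_0$, and $\widehat{A}=\{\widehat a: a\in A\}$ for $A\subset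 V\setminus V_0$. Let $\widehat{Q}=\{x\in V_1: B(x,x)=0\}$. The normalized action is $w\cdot x=\widehat{w(x)}$ for $w\in W$ and $x\in V_1\setminus W(V_0)$; it is well defined on $\widehat{Q}$ and preserves it. All roots lie outside $V_0$; $E$ (resp. $E_I$) is the set of all limits of injective sequences of normalized roots $\widehat{\rho}$ with $\rho\in\Phi$ (resp. $\rho\in\Phi_I$). $\mathrm{conv}$ and $\mathrm{span}$ denote convex hull and linear span. *)

(* Defs.v *)
From HB Require Import structures.
From mathcomp Require Import all_boot all_order all_algebra.
From mathcomp Require Import all_classical all_reals all_analysis.

Set Implicit Arguments.
Unset Strict Implicit.
Unset Printing Implicit Defensive.

Import Order.TTheory GRing.Theory Num.Theory.
Import numFieldNormedType.Exports.

Local Open Scope classical_set_scope.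
Local Open Scope ring_scope.

(** * Coxeter systems *)

(* [None] stands for infinity. *)
Definition coxeter_matrix (n : nat) (m : 'I_n -> 'I_n -> option nat) : Prop :=
  [/\ forall i, m i i = Some 1%N,
      forall i j, m i j = m j i
    & forall i j k, i != j -> m i j = Some k -> (1 < k)%N].

Definition coxeter_relations (G : groupType) (n : nat)
    (m : 'I_n -> 'I_n -> option nat) (f : 'I_n -> G) : Prop :=
  forall i j k, m i j = Some k -> ((f i * f j) ^+ k = 1)%g.

Definition subgroup (G : groupType) (H : set G) : Prop :=
  [/\ H 1%g, forall x y, H x -> H y -> H (x * y)%g
    & forall x, H x -> H (x^-1)%g].

Definition generated_subgroup (G : groupType) (A : set G) : set G :=
  smallest (@subgroup G) A.

(* [W] is the group presented by the generators [s i] and the relations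
   [(s i * s j) ^+ m i j = 1], expressed by its universal property; the
   homomorphism [h] is unique because the [s i] generate [W]. *)
Definition coxeter_system (W : groupType) (n : nat)
    (m : 'I_n -> 'I_n -> option nat) (s : 'I_n -> W) : Prop :=
  [/\ coxeter_matrix m, coxeter_relations m s,
      generated_subgroup (range s) = setT
    & forall (G : groupType) (f : 'I_n -> G), coxeter_relations m f ->
        exists h : {multiplicative W -> G}, forall i, h (s i) = f i].

Definition coxeter_graph (n : nat) (m : 'I_n -> 'I_n -> option nat) :
  rel 'I_n := fun i j => (i != j) && (m i j != Some 2%N).

Definition irreducible_coxeter (n : nat) (m : 'I_n -> 'I_n -> option nat) :
  Prop := forall i j, connect (coxeter_graph m) i j.

(* Standard parabolic subgroups; a subset of the simple roots is given by the
   set [I] of their indices. *)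
Definition parabolic (W : groupType) (n : nat) (s : 'I_n -> W)
    (I : {set 'I_n}) : set W :=
  generated_subgroup [set s i | i in [set` I]].

(** * The geometric representation *)

Definition simple_root (R : realType) (n : nat) (i : 'I_n) : 'rV[R]_n :=
  delta_mx 0 i.

Definition simple_roots (R : realType) (n : nat) (I : {set 'I_n}) :
  set 'rV[R]_n := [set simple_root R i | i in [set` I]].

Arguments simple_roots R {n} I.

Definition bform (R : realType) (n : nat) (B : 'M[R]_n) (u v : 'rV[R]_n) : R :=
  (u *m B *m v^T) 0 0.

Definition coxeter_form (R : realType) (n : nat)
    (m : 'I_n -> 'I_n -> option nat) (B : 'M[R]_n) : Prop :=
  [/\ B^T = B, forall i, B i i = 1,
      forall i j k, i != j -> m i j = Some k -> B i j = - cos (pi / k%:R)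
    & forall i j, m i j = None -> B i j <= -1].

(* Signature of a symmetric matrix: numbers of positive and negative
   coefficients in a diagonal form over an orthogonal basis (well defined by
   Sylvester's law of inertia). *)
Definition has_signature (R : realType) (n : nat) (B : 'M[R]_n) (p q : nat) :
  Prop :=
  exists P : 'M[R]_n, exists d : 'rV[R]_n,
    [/\ P \in unitmx, P *m B *m P^T = diag_mx d,
        #|[pred i | 0 < d 0 i]| = p & #|[pred i | d 0 i < 0]| = q].

(* For [W] generated by [s], these conditions determine [act]. *)
Definition geometric_action (R : realType) (W : groupType) (n : nat)
    (s : 'I_n -> W) (B : 'M[R]_n)
    (act : W -> {linear 'rV[R]_n -> 'rV[R]_n}) : Prop :=
  [/\ forall v, act 1%g v = v,
      forall w1 w2 v, act (w1 * w2)%g v = act w1 (act w2 v)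
    & forall i v, act (s i) v =
        v - (2 * bform B (simple_root R i) v) *: simple_root R i].

Definition orbit_of (R : realType) (W : groupType) (n : nat)
    (act : W -> {linear 'rV[R]_n -> 'rV[R]_n})
    (H : set W) (A : set 'rV[R]_n) : set 'rV[R]_n :=
  [set act w v | w in H & v in A].

Definition root_system (R : realType) (W : groupType) (n : nat)
    (act : W -> {linear 'rV[R]_n -> 'rV[R]_n}) : set 'rV[R]_n :=
  orbit_of act setT (range (@simple_root R n)).

Definition parabolic_roots (R : realType) (W : groupType) (n : nat)
    (s : 'I_n -> W) (act : W -> {linear 'rV[R]_n -> 'rV[R]_n})
    (I : {set 'I_n}) : set 'rV[R]_n :=
  orbit_of act (parabolic s I) (simple_roots R I).

(** * Normalization *)

Definition negative_eigenvector (R : realType) (n : nat) (B : 'M[R]_n)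
    (o : 'rV[R]_n) : Prop :=
  [/\ exists2 lambda : R, lambda < 0 & o *m B = lambda *: o,
      \sum_i o 0 i ^+ 2 = 1 & forall i, 0 < o 0 i].

Definition norm1 (R : realType) (n : nat) (o v : 'rV[R]_n) : R :=
  \sum_i o 0 i * v 0 i.

(* Only meaningful when [norm1 o v != 0]; otherwise the value is [0], which is
   not in the affine hyperplane [norm1 o = 1]. *)
Definition normalize (R : realType) (n : nat) (o v : 'rV[R]_n) : 'rV[R]_n :=
  (norm1 o v)^-1 *: v.

Definition Qhat (R : realType) (n : nat) (B : 'M[R]_n) (o : 'rV[R]_n) :
  set 'rV[R]_n := [set x | norm1 o x = 1 /\ bform B x x = 0].

(** * Limit roots *)

Definition injective_limits (T : topologicalType) (A : set T) : set T :=
  [set x | exists u : nat -> T,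
     [/\ injective u, forall k, A (u k) & u @ \oo --> x]].

Definition limit_roots (R : realType) (W : groupType) (n : nat)
    (act : W -> {linear 'rV[R]_n -> 'rV[R]_n}) (o : 'rV[R]_n) :
  set 'rV[R]_n := injective_limits (normalize o @` root_system act).

Definition parabolic_limit_roots (R : realType) (W : groupType) (n : nat)
    (s : 'I_n -> W) (act : W -> {linear 'rV[R]_n -> 'rV[R]_n})
    (o : 'rV[R]_n) (I : {set 'I_n}) : set 'rV[R]_n :=
  injective_limits (normalize o @` parabolic_roots s act I).

(** * Generating subsets *)

Definition convex_hull (R : realType) (V : lmodType R) (A : set V) : set V :=
  smallest (@convex_set R V) A.

Definition simple_span (R : realType) (n : nat) (I : {set 'I_n}) :
  set 'rV[R]_n := [set` <<[seq simple_root R i | i <- enum I]>>%VS].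

Arguments simple_span R {n} I.

Definition generating (R : realType) (n : nat) (B : 'M[R]_n) (o : 'rV[R]_n)
    (I : {set 'I_n}) : Prop :=
  Qhat B o `&` simple_span R I `<=`
  convex_hull (normalize o @` range (@simple_root R n)) `&` simple_span R I.

(* [W . (bigcup ...)] for the normalized action [x |-> normalize o (act w x)],
   which is defined on [Qhat B o]. *)
Definition F0 (R : realType) (W : groupType) (n : nat)
    (act : W -> {linear 'rV[R]_n -> 'rV[R]_n}) (B : 'M[R]_n)
    (o : 'rV[R]_n) : set 'rV[R]_n :=
  [set normalize o (act w x) | w in [set: W] &
     x in \bigcup_(I in [set I : {set 'I_n} | generating B o I])
            (Qhat B o `&` simple_span R I)].

(* Main.v *)
Require Import Defs.
From HB Require Import structures.
From mathcomp Require Import all_boot all_order all_algebra.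
From mathcomp Require Import all_classical all_reals all_analysis.
From mathcomp Require Import ring lra zify.
Import Order.TTheory GRing.Theory Num.Theory.
Import numFieldNormedType.Exports.
Local Open Scope classical_set_scope.
Local Open Scope ring_scope.
Set Implicit Arguments.
Unset Strict Implicit.
Unset Printing Implicit Defensive.

(** Write h(v) for [norm1 o v].  Since B has signature (n - 1, 1), it is positive
    definite on V_0, so roots with bounded h form a bounded set, and a product of
    group elements close to the identity is trivial because it keeps all simple
    roots positive: only finitely many roots have bounded h.  Consequently a point
    x of Q^ is a limit root as soon as B(x, r) is bounded on an infinite set of
    roots r.

    If I is generating and x is in Q^ /\ span(I), the W_I-orbit of x stays in the
    cone on the simple roots of I.  For w x in this orbit with h(w x) <= 1, the
    numbers B(x, w^-1 alpha_i) = B(w x, alpha_i) are bounded; so either this gives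
    infinitely many roots as required, or some w x has minimal h and is orthogonal
    to the simple roots of its support, and the span of these contains infinitely
    many roots, all orthogonal to w x.  This gives (i), and E contains F_0.

    Conversely, if normalized roots converge to y and x <> y is in F_0, then so do
    the images of x under the reflections in these roots.  Finally F_0 is nonempty:
    a minimal I whose span is not positive definite is generating. *)

(** * Words and length *)

Section Words.
Variables (W : groupType) (n : nat) (s : 'I_n -> W).
Implicit Types (q : seq 'I_n) (w v : W) (i j : 'I_n) (I : {set 'I_n}).

Definition word_prod q : W := (\prod_(i <- q) s i)%g.

Lemma word_prod_nil : word_prod [::] = 1%g.
Proof. by rewrite /word_prod big_nil. Qed.

Lemma word_prod_cons i q : word_prod (i :: q) = (s i * word_prod q)%g.
Proof. by rewrite /word_prod big_cons. Qed.

Lemma word_prod_cat q1 q2 :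
  word_prod (q1 ++ q2) = (word_prod q1 * word_prod q2)%g.
Proof. by rewrite /word_prod big_cat. Qed.

Lemma word_prod_rcons q i : word_prod (rcons q i) = (word_prod q * s i)%g.
Proof. by rewrite -cats1 word_prod_cat /word_prod big_seq1. Qed.

Hypothesis s2 : forall i, (s i * s i = 1)%g.

Lemma generatorV i : (s i)^-1%g = s i.
Proof. exact: mulg1_eq. Qed.

Lemma word_prodV q : (word_prod q)^-1%g = word_prod (rev q).
Proof.
elim: q => [|i q IH]; first by rewrite word_prod_nil invg1.
by rewrite word_prod_cons invgM IH rev_cons word_prod_rcons generatorV.
Qed.

(** As the generators are involutions, inverting a word reverses it, so the products of words over
    [I] are already closed under inverses. *)
Lemma generated_word I w : generated_subgroup [set s i | i in [set` I]] w ->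
  exists2 q, {in q, forall i, i \in I} & w = word_prod q.
Proof.
pose H := [set x | exists2 q, {in q, forall i, i \in I} & x = word_prod q].
apply: (_ : smallest _ _ `<=` H); apply: smallest_sub => [|_ [i iI <-]]; last first.
  exists [:: i]; first by move=> j; rewrite inE => /eqP ->.
  by rewrite /word_prod big_seq1.
split.
- by exists [::]; rewrite // word_prod_nil.
- move=> _ _ [q1 q1I ->] [q2 q2I ->]; exists (q1 ++ q2); rewrite ?word_prod_cat //.
  by move=> j; rewrite mem_cat => /orP[/q1I|/q2I].
- move=> _ [q qI ->]; exists (rev q); rewrite ?word_prodV // => j.
  by rewrite mem_rev => /qI.
Qed.

Lemma subgroup_generated (A : set W) : subgroup (generated_subgroup A).
Proof.
split=> [H [[H1 _ _] _] //|x y Ax Ay H HA|x Ax H HA].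
- by case: (HA) => -[_ HM _] _; exact: (HM _ _ (Ax H HA) (Ay H HA)).
- by case: (HA) => -[_ _ HV] _; exact: (HV _ (Ax H HA)).
Qed.

Hypothesis sgen : generated_subgroup (range s) = setT.

Lemma word_surj w : exists q, w = word_prod q.
Proof.
have /(_ w) := @generated_word [set: 'I_n].
have -> : [set s i | i in [set` [set: 'I_n]%SET]] = range s.
  by apply/seteqP; split=> _ [i _ <-]; exists i => //=; rewrite inE.
by rewrite sgen => /(_ Logic.I)[q _ ->]; exists q.
Qed.

Fact ex_word_size w : exists k, `[< exists2 q, w = word_prod q & size q = k >].
Proof. by have [q wq] := word_surj w; exists (size q); apply/asboolP; exists q. Qed.

Definition word_length w := ex_minn (ex_word_size w).

Lemma word_length_le q : (word_length (word_prod q) <= size q)%N.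
Proof.
rewrite /word_length; case: ex_minnP => k _; apply.
by apply/asboolP; exists q.
Qed.

Lemma reduced_word w : exists2 q, w = word_prod q & size q = word_length w.
Proof. by rewrite /word_length; case: ex_minnP => k /asboolP. Qed.

Lemma word_length_mul w q :
  (word_length (w * word_prod q)%g <= word_length w + size q)%N.
Proof.
have [p -> <-] := reduced_word w.
by rewrite -word_prod_cat -size_cat word_length_le.
Qed.

Lemma word_length_mulr w i : (word_length (w * s i)%g <= (word_length w).+1)%N.
Proof.
have -> : s i = word_prod [:: i] by rewrite /word_prod big_seq1.
by rewrite -addn1 word_length_mul.
Qed.

Lemma mulgss w i : (w * s i * s i = w)%g.
Proof. by rewrite -mulgA s2 mulg1. Qed.

(** The alternating word of length [k] ending in [j]. The recursion is at the right end, where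
    multiplication by a generator is tested. *)
Fixpoint alt i j k : seq 'I_n :=
  if k is k'.+1 then rcons (alt j i k') j else [::].

Lemma size_alt i j k : size (alt i j k) = k.
Proof. by elim: k i j => //= k IH i j; rewrite size_rcons IH. Qed.

Lemma alt_cat i j a b : exists2 q, size q = a & alt i j (a + b) = q ++ alt i j b.
Proof.
elim: b i j => [|b IH] i j.
  by exists (alt i j a); rewrite ?size_alt ?addn0 ?cats0.
by have [q qa e] := IH j i; exists q => //; rewrite addnS /= e rcons_cat.
Qed.

Lemma alt_double i j k : word_prod (alt i j k.*2) = ((s i * s j) ^+ k)%g.
Proof.
elim: k => [|k IH]; first by rewrite word_prod_nil.
by rewrite doubleS /= !word_prod_rcons IH expgSr mulgA.
Qed.

Lemma alt_doubleS i j k :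
  word_prod (alt i j k.*2.+1) = (s j * (s i * s j) ^+ k)%g.
Proof.
elim: k => [|k IH]; first by rewrite /= word_prod_cons word_prod_nil.
rewrite doubleS.
have -> : alt i j k.*2.+3 = rcons (rcons (alt i j k.*2.+1) i) j by [].
by rewrite 2!word_prod_rcons IH expgSr !mulgA.
Qed.

Lemma expg_swap i j k : ((s j * s i) ^+ k = ((s i * s j) ^+ k)^-1)%g.
Proof. by rewrite -expVgn invgM !generatorV. Qed.

(** With [h = k./2] the words are [(s i * s j) ^+ h] and its inverse, preceded for odd [k] by [s j]
    and [s i]; in both cases their equality amounts to the relation of exponent [k]. *)
Lemma braid i j k : ((s i * s j) ^+ k = 1)%g ->
  word_prod (alt i j k) = word_prod (alt j i k).
Proof.
rewrite -{1 2 3}(odd_double_half k); set h := k./2.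
case: (odd k); rewrite ?add1n ?add0n => e.
  rewrite !alt_doubleS (expg_swap i j); apply: (mulIg ((s i * s j) ^+ h)%g).
  rewrite mulgVK -mulgA -expgnDr addnn; apply: (mulgI (s i)).
  by rewrite s2 mulgA -expgS.
rewrite !alt_double (expg_swap i j); apply: (mulIg ((s i * s j) ^+ h)%g).
by rewrite mulVg -expgnDr addnn.
Qed.

Lemma word_length_le_mul v q w : w = (v * word_prod q)%g ->
  (word_length w <= word_length v + size q)%N.
Proof. by move=> ->; exact: word_length_mul. Qed.

(** The last letter cannot be [i], since [s i] would then shorten [w]. Once the last letter [j] is
    removed, [s j] lengthens the product, so the induction continues with [i] and [j] exchanged. *)
Lemma reduced_alt u i j v w : all (mem [:: i; j]) u ->
  w = (v * word_prod u)%g -> (word_length v + size u)%N = word_length w ->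
  (word_length w <= word_length (w * s i)%g)%N -> u = alt i j (size u).
Proof.
elim/last_ind: u i j w => // u x IH i j w.
rewrite all_rcons size_rcons word_prod_rcons => /andP[xij uij] wE lw lwi.
have wx : (w * s x)%g = (v * word_prod u)%g by rewrite wE !mulgA mulgss.
move: xij; rewrite !inE => /orP[] /eqP ex; subst x.
  move: lwi; rewrite wx => /leq_trans/(_ (word_length_mul _ _)).
  by rewrite -lw addnS ltnn.
congr (rcons _ _); apply: (IH j i (w * s j)%g) => //.
- by apply: sub_all uij => x; rewrite !inE orbC.
- apply/eqP; rewrite eqn_leq (word_length_le_mul wx) andbT -ltnS -addnS lw.
  by have := word_length_mulr (w * s j)%g j; rewrite mulgss.
- by rewrite mulgss wx (leq_trans (word_length_mul _ _)) // -lw addnS.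
Qed.

(** Otherwise the braid relation would turn the last [m] letters into an alternating word ending in
    [i], and [s i] would shorten [w]. *)
Lemma alt_short v w i j k m : w = (v * word_prod (alt i j k))%g ->
  (word_length v + k)%N = word_length w -> (0 < m)%N ->
  ((s i * s j) ^+ m = 1)%g ->
  (word_length w <= word_length (w * s i)%g)%N -> (k < m)%N.
Proof.
move=> wE lw m0 e lwi; rewrite ltnNge; apply/negP => mk.
have [q qa] := alt_cat i j (k - m) m; rewrite subnK // => qE.
move: wE lwi lw; rewrite qE word_prod_cat (braid e) -(prednK m0) /= word_prod_rcons => wE.
have -> : (w * s i)%g = (v * word_prod (q ++ alt i j m.-1))%g.
  by rewrite wE word_prod_cat !mulgA mulgss.
move=> + lw; rewrite -lw => /leq_trans/(_ (word_length_mul _ _)).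
rewrite size_cat size_alt qa leq_add2l => ?; lia.
Qed.

(* [u] is taken of maximal length, so that neither [s i] nor [s j] shortens [v]. *)
Lemma dihedral_factor i j w : exists v, exists2 u, all (mem [:: i; j]) u &
  [/\ w = (v * word_prod u)%g, (word_length v + size u)%N = word_length w,
      (word_length v <= word_length (v * s i)%g)%N,
      (word_length v <= word_length (v * s j)%g)%N &
      (word_length (w * s j)%g < word_length w -> word_length v < word_length w)%N].
Proof.
pose P k := `[< exists v, exists2 u, all (mem [:: i; j]) u &
  [/\ w = (v * word_prod u)%g, (word_length v + size u)%N = word_length w &
   size u = k] >].
have P0 : exists k, P k.
  exists 0%N; apply/asboolP; exists w, [::] => //.
  by rewrite word_prod_nil mulg1 addn0.
have Pb k : P k -> (k <= word_length w)%N.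
  by move=> /asboolP[v [u _ [_ <- <-]]]; rewrite leq_addl.
case: (ex_maxnP P0 Pb) => k /asboolP[v [u ua [wE lw uk]]] kmax.
exists v, u => //.
have H x : x \in [:: i; j] -> (word_length v <= word_length (v * s x)%g)%N.
  move=> xij; rewrite leqNgt; apply/negP => lvx.
  have wE' : w = (v * s x * word_prod (x :: u))%g.
    by rewrite word_prod_cons mulgA mulgss.
  have := word_length_le_mul wE' => /= lw'.
  suff /kmax : P k.+1 by rewrite ltnn.
  apply/asboolP; exists (v * s x)%g, (x :: u); first by rewrite /= ua andbT.
  split=> //=; last by rewrite uk.
  by apply/eqP; rewrite eqn_leq lw' -lw -addSnnS leq_add2r lvx.
split=> //; try (by apply: H; rewrite !inE eqxx ?orbT).
(* [w = (w * s j) * s j] is a factorization with a tail of length one, so the longest tail is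
   nonempty. *)
move=> lwj; rewrite -lw -addn1 leq_add2l uk; apply: kmax.
apply/asboolP; exists (w * s j)%g, [:: j]; first by rewrite /= !inE eqxx orbT.
rewrite word_prod_cons word_prod_nil mulg1 mulgss addn1; split=> //.
by apply/eqP; rewrite eqn_leq lwj; have := word_length_mulr (w * s j)%g j; rewrite mulgss.
Qed.

End Words.

(** * The bilinear form *)

Section BilinearForm.
Variables (R : realType) (n : nat) (B : 'M[R]_n).
Implicit Types (u v x y : 'rV[R]_n) (a : R) (i j : 'I_n).

Local Notation "''[' u , v ]" := (bform B u v) (format "''[' u ,  v ]").
Local Notation alpha := (@simple_root R n).

Lemma bformDl u v x : '[u + v, x] = '[u, x] + '[v, x].
Proof. by rewrite /bform !mulmxDl mxE. Qed.

Lemma bformDr u v x : '[x, u + v] = '[x, u] + '[x, v].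
Proof. by rewrite /bform linearD mulmxDr mxE. Qed.

Lemma bformZl a u x : '[a *: u, x] = a * '[u, x].
Proof. by rewrite /bform -!scalemxAl mxE. Qed.

Lemma bformZr a u x : '[x, a *: u] = a * '[x, u].
Proof. by rewrite /bform linearZ -scalemxAr mxE. Qed.

Lemma bformNl u x : '[- u, x] = - '[u, x].
Proof. by rewrite -scaleN1r bformZl mulN1r. Qed.

Lemma bformNr u x : '[x, - u] = - '[x, u].
Proof. by rewrite -scaleN1r bformZr mulN1r. Qed.

Lemma bformBl u v x : '[u - v, x] = '[u, x] - '[v, x].
Proof. by rewrite bformDl bformNl. Qed.

Lemma bformBr u v x : '[x, u - v] = '[x, u] - '[x, v].
Proof. by rewrite bformDr bformNr. Qed.

Lemma bform0l x : '[0, x] = 0.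
Proof. by rewrite -(scale0r 0) bformZl mul0r. Qed.

Lemma bform0r x : '[x, 0] = 0.
Proof. by rewrite -(scale0r 0) bformZr mul0r. Qed.

Definition bformE := (bformDl, bformDr, bformBl, bformBr, bformNl, bformNr,
  bformZl, bformZr).

Lemma bform_simple i j : '[alpha i, alpha j] = B i j.
Proof. by rewrite /bform /simple_root -rowE trmx_delta -colE !mxE. Qed.

Lemma bform_suml u v : '[u, v] = \sum_i u 0 i * '[alpha i, v].
Proof.
rewrite {1}(row_sum_delta u) /bform !mulmx_suml summxE.
by apply: eq_bigr => i _; rewrite -!scalemxAl mxE.
Qed.

Lemma simple_rootE i j : alpha i 0 j = (j == i)%:R.
Proof. by rewrite mxE. Qed.

Hypothesis Bsym : B^T = B.

Lemma bformC u v : '[u, v] = '[v, u].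
Proof.
rewrite /bform -[u *m B *m v^T]trmxK mxE.
by rewrite !trmx_mul trmxK Bsym mulmxA.
Qed.

End BilinearForm.

(** * Positivity of roots *)

(* Chebyshev polynomials of the second kind, shifted by one:
   [cheb (cos t) k = sin (k t) / sin t]. *)
Fixpoint cheb (R : realType) (p : R) (k : nat) : R :=
  match k with
  | 0 => 0
  | k'.+1 => if k' is k''.+1 then 2 * p * cheb p k' - cheb p k'' else 1
  end.

(** * Nonnegativity of the Chebyshev values *)

Section Cheb.
Variable R : realType.
Implicit Types (p t : R) (k : nat).

Lemma chebSS p k : cheb p k.+2 = 2 * p * cheb p k.+1 - cheb p k.
Proof. by []. Qed.

(** Nonnegativity alone is not inductive; for [1 <= p] the sequence is also nondecreasing, and the
    two facts carry each other along. *)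
Lemma cheb_ge0_of_ge1 p k : 1 <= p -> 0 <= cheb p k.
Proof.
move=> p1; suff: 0 <= cheb p k /\ cheb p k <= cheb p k.+1 by case.
elim: k => [|k [k0 kS]]; first by rewrite /=.
rewrite chebSS; have kS0 := le_trans k0 kS; split=> //.
by have := ler_wpM2r kS0 p1; lra.
Qed.

Lemma cheb_sin t k : cheb (cos t) k * sin t = sin (k%:R * t).
Proof.
suff: cheb (cos t) k * sin t = sin (k%:R * t) /\
      cheb (cos t) k.+1 * sin t = sin (k.+1%:R * t) by case.
elim: k => [|k [IH IHS]]; first by rewrite !mul0r sin0 !mul1r.
split=> //; rewrite chebSS mulrBl IH -(mulrA (2 * cos t)) IHS.
have -> : k.+2%:R * t = k.+1%:R * t + t by rewrite -natr1 mulrDl mul1r.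
have -> : k%:R * t = k.+1%:R * t - t by rewrite -natr1 mulrDl mul1r addrK.
by rewrite !sinD sinN cosN; ring.
Qed.

(** For [k <= m] the angle [k * pi / m] stays in [[0, pi]], so the quotient of sines is
    nonnegative. *)
Lemma cheb_ge0_of_cos (m k : nat) : (1 < m)%N -> (k <= m)%N ->
  0 <= cheb (cos (pi / m%:R)) k :> R.
Proof.
move=> m1 km; have m0 : 0 < m%:R :> R by rewrite ltr0n; lia.
have s0 : 0 < sin (pi / m%:R : R).
  apply: sin_gt0_pi; rewrite ?divr_gt0 ?pi_gt0 //.
  by rewrite ltr_pdivrMr // ltr_pMr ?pi_gt0 // ltr1n.
rewrite -(pmulr_lge0 _ s0) cheb_sin; apply: sin_ge0_pi; apply/andP; split.
  by rewrite mulr_ge0 ?divr_ge0 ?pi_ge0 ?ler0n.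
rewrite mulrCA -[leRHS]mulr1; apply: ler_wpM2l; first exact: pi_ge0.
by rewrite ler_pdivrMr // mul1r ler_nat.
Qed.

End Cheb.

(** * Action of words on simple roots *)

Section Positivity.
Variables (R : realType) (W : groupType) (n : nat).
Variables (m : 'I_n -> 'I_n -> option nat) (s : 'I_n -> W) (B : 'M[R]_n).
Variable act : W -> {linear 'rV[R]_n -> 'rV[R]_n}.
Hypothesis hWS : coxeter_system m s.
Hypothesis hB : coxeter_form m B.
Hypothesis hact : geometric_action s B act.
Implicit Types (u v x y : 'rV[R]_n) (i j : 'I_n) (w g : W).

Local Notation "''[' u , v ]" := (bform B u v) (format "''[' u ,  v ]").
Local Notation alpha := (@simple_root R n).

Lemma coxeter_generator2 i : (s i * s i = 1)%g.
Proof. by have [[+ _ _] + _ _] := hWS => /(_ i) e /(_ i i 1%N e). Qed.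

Lemma coxeter_generated : generated_subgroup (range s) = setT.
Proof. by case: hWS. Qed.

Local Notation s2 := coxeter_generator2.
Local Notation len := (word_length s2 coxeter_generated).

Lemma coxeter_bformC u v : '[u, v] = '[v, u].
Proof. by apply: bformC; case: hB. Qed.

Lemma bform_simple1 i : '[alpha i, alpha i] = 1.
Proof. by rewrite bform_simple; case: hB. Qed.

Lemma act1 v : act 1%g v = v.
Proof. by case: hact. Qed.

Lemma actM w g v : act (w * g)%g v = act w (act g v).
Proof. by case: hact. Qed.

Lemma actK w : cancel (act w) (act w^-1%g).
Proof. by move=> v; rewrite -actM mulVg act1. Qed.

Lemma actKV w : cancel (act w^-1%g) (act w).
Proof. by move=> v; rewrite -actM mulgV act1. Qed.

Lemma act_generator i v : act (s i) v = v - (2 * '[alpha i, v]) *: alpha i.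
Proof. by case: hact. Qed.

Lemma act_generator_simple i : act (s i) (alpha i) = - alpha i.
Proof. by rewrite act_generator bform_simple1 mulr1 scaler_nat mulr2n opprD addNKr. Qed.

Lemma bform_act w u v : '[act w u, act w v] = '[u, v].
Proof.
have [q ->] := word_surj s2 coxeter_generated w; elim: q u v => [|i q IH] u v.
  by rewrite word_prod_nil !act1.
rewrite word_prod_cons !actM !act_generator !bformE bform_simple1 IH.
by rewrite (coxeter_bformC _ (alpha i)); ring.
Qed.

(** In the plane of the two simple roots, each new reflection changes one coordinate, by the
    Chebyshev recursion at [- B i j]. *)
Lemma act_alt i j k : act (word_prod s (alt i j k)) (alpha i) =
  if odd k then cheb (- B i j) k *: alpha i + cheb (- B i j) k.+1 *: alpha j
  else cheb (- B i j) k.+1 *: alpha i + cheb (- B i j) k *: alpha j.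
Proof.
have BC a b : B a b = B b a by rewrite -!bform_simple coxeter_bformC.
pose P k := forall i j, act (word_prod s (alt i j k)) (alpha i) =
  if odd k then cheb (- B i j) k *: alpha i + cheb (- B i j) k.+1 *: alpha j
  else cheb (- B i j) k.+1 *: alpha i + cheb (- B i j) k *: alpha j.
suff: P k /\ P k.+1 by case=> + _; apply.
elim: k {i j} => [|k [IH IHS]]; split=> // i j.
- by rewrite /= word_prod_nil act1 scale1r scale0r addr0.
- rewrite /= word_prod_cons word_prod_nil mulg1 act_generator bform_simple BC.
  by rewrite scale1r subr0 mulr1 mulrN scaleNr.
rewrite [alt _ _ _]/= -[rcons (alt _ _ _) i]/(alt j i k.+1).
rewrite word_prod_rcons actM act_generator bform_simple linearB linearZ IHS.
rewrite [alt _ _ _]/= word_prod_rcons actM act_generator_simple linearN IH.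
rewrite (BC j i) !chebSS /= negbK; case: (odd k) => /=.
  by apply/rowP => l; rewrite !mxE; ring.
by apply/rowP => l; rewrite !mxE; ring.
Qed.

(* Humphreys, Reflection Groups and Coxeter Groups, Theorem 5.4. *)
Lemma act_simple_ge0 w i : (len w <= len (w * s i)%g)%N ->
  forall l, 0 <= act w (alpha i) 0 l.
Proof.
have [k] := ubnP (len w); elim: k w i => [|k IH] w i lwk lwi l; first by [].
have [q] := reduced_word s2 coxeter_generated w.
case/lastP: q => [|q j] wE lw.
  by rewrite wE word_prod_nil act1 simple_rootE ler0n.
have lwj : (len (w * s j)%g < len w)%N.
  by rewrite -lw wE word_prod_rcons (mulgss s2) size_rcons ltnS word_length_le.
have ij : i != j by apply: contraTneq lwj => <-; rewrite -leqNgt.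
have [v [u uij [wE' lvu lvi lvj /(_ lwj) lvw]]] := dihedral_factor s2 coxeter_generated i j w.
have lvk : (len v < k)%N by apply: leq_trans lvw _.
have ua := reduced_alt uij wE' lvu lwi.
(* For finite [m i j], [alt_short] makes [u] shorter than [m i j], which keeps the index within
   reach of [cheb_ge0_of_cos]; for infinite [m i j], [- B i j] is at least 1. *)
have Bge0 t : (t <= (size u).+1)%N -> 0 <= cheb (- B i j) t.
  move=> tu; case E : (m i j) => [M|]; last first.
    by apply: cheb_ge0_of_ge1; case: hB => _ _ _ /(_ _ _ E); lra.
  have M1 : (1 < M)%N by case: hWS => -[_ _ /(_ _ _ _ ij E)].
  have -> : - B i j = cos (pi / M%:R).
    by case: hB => _ _ /(_ _ _ _ ij E) -> _; rewrite opprK.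
  apply: cheb_ge0_of_cos => //; apply: (leq_trans tu).
  apply: (@alt_short _ _ _ s2 coxeter_generated v w i j) => //; rewrite -?ua //.
  - exact: ltnW.
  - by case: hWS => _ + _ _ => /(_ _ _ _ E).
have vi := IH _ _ lvk lvi; have vj := IH _ _ lvk lvj.
rewrite wE' ua actM act_alt.
by case: odd; rewrite linearD !linearZ !mxE addr_ge0 // mulr_ge0 ?vi ?vj ?Bge0.
Qed.

(** A nontrivial [w] sends the simple root of the last letter of a reduced word to a vector without
    positive coordinates. The hypothesis survives small perturbations of the identity, which is what
    discreteness needs. *)
Lemma act_id w : (forall i, 0 < act w (alpha i) 0 i) -> w = 1%g.
Proof.
have [q] := reduced_word s2 coxeter_generated w.
case/lastP: q => [|q i] wE lw H; first by rewrite wE word_prod_nil.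
have E : (w * s i * s i)%g = w by exact: (mulgss s2).
have le_len : (len (w * s i)%g <= len (w * s i * s i)%g)%N.
  rewrite E -lw wE word_prod_rcons (mulgss s2) size_rcons ltnW // ltnS.
  exact: word_length_le.
have := act_simple_ge0 le_len i.
by rewrite actM act_generator_simple linearN mxE oppr_ge0 => /(lt_le_trans (H i)); rewrite ltxx.
Qed.

End Positivity.

(** * Lorentzian geometry *)

Section Lorentz.
Variables (R : realType) (n : nat) (B : 'M[R]_n) (o : 'rV[R]_n).
Hypothesis Bsym : B^T = B.
Hypothesis hsign : has_signature B n.-1 1.
Hypothesis ho : negative_eigenvector B o.
Implicit Types (u v x y : 'rV[R]_n) (i j : 'I_n) (a : R).

Local Notation "''[' u , v ]" := (bform B u v) (format "''[' u ,  v ]").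
Local Notation norm1 := (norm1 o).

Lemma norm1D u v : norm1 (u + v) = norm1 u + norm1 v.
Proof.
by rewrite /norm1 -big_split; apply: eq_bigr => i _; rewrite mxE mulrDr.
Qed.

Lemma norm1Z a v : norm1 (a *: v) = a * norm1 v.
Proof. by rewrite /norm1 mulr_sumr; apply: eq_bigr => i _; rewrite mxE mulrCA. Qed.

Lemma norm1N v : norm1 (- v) = - norm1 v.
Proof. by rewrite -scaleN1r norm1Z mulN1r. Qed.

Lemma norm1B u v : norm1 (u - v) = norm1 u - norm1 v.
Proof. by rewrite norm1D norm1N. Qed.

Lemma norm1_eigen : norm1 o = 1.
Proof. by case: ho => _ <- _; apply: eq_bigr => i _; rewrite expr2. Qed.

Lemma norm1_simple i : norm1 (simple_root R i) = o 0 i.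
Proof.
rewrite /norm1 (bigD1 i) //= big1 ?addr0 => [|j ji]; rewrite simple_rootE.
  by rewrite eqxx mulr1.
by rewrite (negbTE ji) mulr0.
Qed.

Lemma eigen_gt0 i : 0 < o 0 i.
Proof. by case: ho => _ _. Qed.

Lemma bform_eigen : exists2 l, l < 0 & forall v, '[o, v] = l * norm1 v.
Proof.
case: ho => -[l l0 oB] _ _; exists l => // v.
rewrite /bform oB -scalemxAl mxE; congr (_ * _); rewrite mxE.
by apply: eq_bigr => i _; rewrite mxE.
Qed.

(** Only one index is left outside the [n - 1] positive ones, and it is the negative one, so no
    diagonal entry vanishes. *)
Lemma signature_diag : exists P d (i0 : 'I_n), [/\ P \in unitmx,
  P *m B *m P^T = diag_mx d, d 0 i0 < 0 & forall i, i != i0 -> 0 < d 0 i].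
Proof.
case: hsign => P [d [Pu PB c1 c2]].
have /card_gt0P[i0 i0d] : (0 < #|[pred i | (d 0 i < 0)%R]|)%N by rewrite c2.
exists P, d, i0; split=> // i ii0; apply: contraNT ii0 => id.
have n0 : (0 < n)%N by apply: leq_ltn_trans (ltn_ord i0).
have : (#|[predC [pred i | (0 < d 0 i)%R]]| <= 1)%N.
  rewrite -(leq_add2l #|[pred i | (0 < d 0 i)%R]|) cardC card_ord c1.
  by rewrite addn1 prednK.
move/card_le1_eqP => /(_ i i0) -> //; rewrite !inE //.
by rewrite -leNgt ltW.
Qed.

Lemma bform_diag (P : 'M[R]_n) (d c : 'rV[R]_n) : P *m B *m P^T = diag_mx d ->
  '[c *m P, c *m P] = \sum_i d 0 i * c 0 i ^+ 2.
Proof.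
move=> PB; rewrite /bform trmx_mul !mulmxA.
rewrite -(mulmxA c P) -(mulmxA c (P *m B)) PB mul_mx_diag mxE.
by apply: eq_bigr => i _; rewrite !mxE; ring.
Qed.

Lemma form_unit : B \in unitmx.
Proof.
have [P [d [i0 [Pu PB d0 dp]]]] := signature_diag.
have : P *m B *m P^T \in unitmx.
  rewrite PB unitmxE det_diag unitfE; apply/prodf_neq0 => i _.
  have [->|ii0] := eqVneq i i0; first by rewrite lt_eqF.
  by rewrite gt_eqF ?dp.
by rewrite !unitmx_mul => /andP[/andP[]].
Qed.

Lemma bform_eigen_lt0 : '[o, o] < 0.
Proof.
by have [l l0 ->] := bform_eigen; rewrite norm1_eigen mulr1.
Qed.

(** Otherwise the form would be negative semidefinite on the plane of [o] and [v], and this plane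
    would contain a nonzero vector without component along the single negative axis. *)
Lemma bform_gt0 v : norm1 v = 0 -> v != 0 -> 0 < '[v, v].
Proof.
move=> v1 v0; rewrite ltNge; apply/negP => vv.
have [P [d [i0 [Pu PB d0 dp]]]] := signature_diag.
have ov : '[o, v] = 0 by have [l l0 ->] := bform_eigen; rewrite v1 mulr0.
have vo : '[v, o] = 0 by rewrite bformC.
have nn (f : 'rV[R]_n) : f 0 i0 = 0 -> forall i, 0 <= d 0 i * f 0 i ^+ 2.
  move=> f0 i; have [->|/dp di] := eqVneq i i0.
    by rewrite f0 expr0n mulr0.
  by rewrite mulr_ge0 ?sqr_ge0 // ltW.
pose c := o *m invmx P; pose e := v *m invmx P.
have oE : o = c *m P by rewrite mulmxKV.
have vE : v = e *m P by rewrite mulmxKV.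
pose f := e 0 i0 *: c - c 0 i0 *: e.
have f0 : f 0 i0 = 0 by rewrite !mxE; ring.
have fE : f *m P = e 0 i0 *: o - c 0 i0 *: v.
  by rewrite mulmxBl -!scalemxAl -oE -vE.
have ff : '[f *m P, f *m P] <= 0.
  have -> : '[f *m P, f *m P] = e 0 i0 ^+ 2 * '[o, o] + c 0 i0 ^+ 2 * '[v, v].
    by rewrite fE !bformE vo ov; ring.
  by rewrite -oppr_ge0 opprD addr_ge0 ?oppr_ge0 ?mulr_ge0_le0 ?sqr_ge0 // ltW // bform_eigen_lt0.
have fz : f = 0.
  apply/rowP => i; rewrite [RHS]mxE; have [->|ii0] := eqVneq i i0; first by rewrite f0.
  move: ff; rewrite (bform_diag _ PB) => ff.
  have /eqP : \sum_i d 0 i * f 0 i ^+ 2 == 0.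
    by rewrite eq_le ff sumr_ge0 // => j _; exact: nn.
  move/eqP; rewrite psumr_eq0 => [/allP/(_ i)|j _]; last exact: nn.
  rewrite mem_index_enum => /(_ isT) /=; rewrite mulf_eq0 (gt_eqF (dp _ ii0)) /=.
  by rewrite sqrf_eq0 => /eqP.
have e0 : e 0 i0 = 0.
  have := congr1 norm1 fE; rewrite norm1B !norm1Z norm1_eigen v1 fz mul0mx.
  by rewrite -(scale0r o) norm1Z mul0r mulr1 mulr0 subr0.
have c0 : c 0 i0 = 0.
  move/esym/eqP: fE; rewrite fz mul0mx e0 scale0r sub0r oppr_eq0 scaler_eq0.
  by rewrite (negbTE v0) orbF => /eqP.
have := bform_eigen_lt0; rewrite oE (bform_diag _ PB) ltNge sumr_ge0 // => i _.
exact: nn.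
Qed.

Lemma bform_ge0 v : norm1 v = 0 -> 0 <= '[v, v].
Proof.
move=> v1; have [->|v0] := eqVneq v 0; first by rewrite bform0l.
by rewrite ltW // bform_gt0.
Qed.

Lemma cauchy_schwarz u v : norm1 u = 0 -> norm1 v = 0 ->
  '[u, v] ^+ 2 <= '[u, u] * '[v, v].
Proof.
move=> u1 v1; have [->|v0] := eqVneq v 0.
  by rewrite bform0r expr0n bform0l mulr0.
have vv := bform_gt0 v1 v0; set t := '[u, v] / '[v, v].
have E : '[u, u] * '[v, v] - '[u, v] ^+ 2 = '[v, v] * '[u - t *: v, u - t *: v].
  by rewrite !bformE (bformC Bsym v u) /t; field; rewrite gt_eqF.
rewrite -subr_ge0 E mulr_ge0 ?(ltW vv) // bform_ge0 //.
by rewrite norm1B norm1Z u1 v1 mulr0 subr0.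
Qed.

(** Since [B] is invertible, every coordinate is the product with a fixed vector; projected along
    [o] to V_0, this vector still computes the coordinate on V_0, and Cauchy-Schwarz applies. *)
Lemma coordinate_bound : exists2 K, 0 < K &
  forall v i, norm1 v = 0 -> v 0 i ^+ 2 <= K * '[v, v].
Proof.
pose z i : 'rV[R]_n := simple_root R i *m invmx B.
pose z' i := z i - norm1 (z i) *: o.
have z1 i : norm1 (z' i) = 0.
  by rewrite norm1B norm1Z norm1_eigen mulr1 subrr.
have zv v i : norm1 v = 0 -> '[v, z' i] = v 0 i.
  move=> v1; rewrite bformC // bformBl bformZl.
  have [l _ ->] := bform_eigen; rewrite v1 !mulr0 subr0.
  by rewrite /bform mulmxKV ?form_unit // /simple_root -rowE !mxE.
have zz i : 0 <= '[z' i, z' i] by exact: bform_ge0.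
exists (1 + \sum_i '[z' i, z' i]).
  by rewrite ltr_wpDr ?ltr01 ?sumr_ge0.
move=> v i v1; rewrite -{1}(zv v i v1) (le_trans (cauchy_schwarz v1 (z1 i))) //.
rewrite mulrC ler_wpM2r ?bform_ge0 // (bigD1 i) //= addrCA lerDl addr_ge0 ?ler01 //.
by rewrite sumr_ge0.
Qed.

Lemma norm1_neq0 v : '[v, v] <= 0 -> v != 0 -> norm1 v != 0.
Proof.
by move=> vv; apply: contraNneq => /bform_gt0 v0; apply: contraLR vv => /v0; rewrite ltNge.
Qed.

Lemma norm1_normalize v : norm1 v != 0 -> norm1 (normalize o v) = 1.
Proof. by move=> v0; rewrite norm1Z mulVf. Qed.

Lemma normalizeK v : norm1 v != 0 -> v = norm1 v *: normalize o v.
Proof. by move=> v0; rewrite scalerA mulfV // scale1r. Qed.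

Lemma normalizeZ a v : a != 0 -> normalize o (a *: v) = normalize o v.
Proof.
move=> a0; rewrite /normalize norm1Z scalerA; congr (_ *: _).
have [->|v0] := eqVneq (norm1 v) 0; first by rewrite mulr0 invr0 mul0r.
by field; rewrite a0 v0.
Qed.

Lemma Qhat_normalize v : norm1 v != 0 -> '[v, v] = 0 -> Qhat B o (normalize o v).
Proof.
move=> v0 vv; split; first exact: norm1_normalize.
by rewrite !bformE vv !mulr0.
Qed.

Lemma Qhat_norm1B x y : Qhat B o x -> Qhat B o y -> norm1 (x - y) = 0.
Proof. by move=> [x1 _] [y1 _]; rewrite norm1B x1 y1 subrr. Qed.

Lemma Qhat_bformB x y : Qhat B o x -> Qhat B o y ->
  '[x - y, x - y] = - 2 * '[x, y].
Proof.
by move=> [_ x0] [_ y0]; rewrite !bformE x0 y0 (bformC Bsym y x); ring.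
Qed.

Lemma Qhat_le0 x y : Qhat B o x -> Qhat B o y -> '[x, y] <= 0.
Proof.
move=> Qx Qy; have := bform_ge0 (Qhat_norm1B Qx Qy).
by rewrite Qhat_bformB // mulNr oppr_ge0 pmulr_rle0.
Qed.

Lemma Qhat_lt0 x y : Qhat B o x -> Qhat B o y -> x != y -> '[x, y] < 0.
Proof.
move=> Qx Qy; rewrite -subr_eq0 => /(bform_gt0 (Qhat_norm1B Qx Qy)).
by rewrite Qhat_bformB // mulNr oppr_gt0 pmulr_rlt0.
Qed.

(** Normalized isotropic vectors have nonpositive product, so heights of opposite sign would make
    ['[x, y]] nonnegative. *)
Lemma isotropic_sheet x y : '[x, x] = 0 -> '[y, y] = 0 -> 0 < norm1 x ->
  norm1 y != 0 -> '[x, y] < 0 -> 0 < norm1 y.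
Proof.
move=> xx yy x1 y0; apply: contraTT; rewrite -leNgt -leNgt => y1.
have x0 : norm1 x != 0 by rewrite gt_eqF.
rewrite (normalizeK x0) (normalizeK y0) bformZl bformZr mulrA.
rewrite mulr_le0 //; first by rewrite mulr_ge0_le0 // ltW.
by apply: Qhat_le0; exact: Qhat_normalize.
Qed.

End Lorentz.

(** * Injective limits *)

Lemma finite_image_inj (U V : Type) (f : U -> V) (A : set U) :
  {in A &, injective f} -> finite_set (f @` A) -> finite_set A.
Proof. by move=> /inj_card_eq /eq_finite_set ->. Qed.

Lemma injective_leaves_finite (T : Type) (u : nat -> T) (F : set T) :
  injective u -> finite_set F -> \forall k \near \oo, ~ F (u k).
Proof.
move=> uI Ff.
have : finite_set (u @^-1` F).
  apply: (@finite_image_inj _ _ u) => [j k _ _|]; first exact: uI.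
  by apply: sub_finite_set Ff => _ [k Fk <-].
move=> /finite_seqP[l lE]; exists (\max_(k <- l) k).+1 => // k /= kl Fk.
have kl' : k \in l by have : [set` l] k by rewrite -lE.
by move: kl; rewrite ltnNge => /negP[]; exact: (@leq_bigmax_seq _ l xpredT id k).
Qed.

Section InjectiveLimits.
Variables (R : realType) (T : pseudoMetricType R).
Implicit Types (A : set T) (x : T).

(** Backwards, a sequence is built greedily: the term of index [k] is taken in the ball of radius
    [1 / (k + 1)], away from all earlier terms. *)
Lemma injective_limitsP A x : injective_limits A x <->
  forall e : R, 0 < e -> infinite_set (A `&` ball x e).
Proof.
split=> [[u [uI uA /cvg_ballP ux]] e e0 fin|H].
  have [N _ HN] := ux _ e0.
  apply: infinite_nat; apply: (@finite_image_inj _ _ (fun k => u (k + N)%N)).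
    by move=> k k' _ _ /uI /eqP; rewrite eqn_add2r => /eqP.
  apply: sub_finite_set fin => _ [k _ <-]; split; first exact: uA.
  by apply: HN => /=; rewrite leq_addl.
have ex (k : nat) (l : seq T) : exists y, (A `&` ball x k.+1%:R^-1) y /\ ~ [set` l] y.
  apply: contrapT => /forallNP nex; apply: (H k.+1%:R^-1); first by rewrite invr_gt0.
  apply: sub_finite_set (finite_seq l) => y Ay; apply: contrapT => yl.
  exact: (nex y).
pose pick k l := sval (cid (ex k l)).
have pickP k l : (A `&` ball x k.+1%:R^-1) (pick k l) /\ ~ [set` l] (pick k l).
  by rewrite /pick; case: cid.
pose L k := iteri k (fun j l => pick j l :: l) [::].
have LS k : L k.+1 = pick k (L k) :: L k by [].
pose u k := pick k (L k).
have uL j k : (j < k)%N -> u j \in L k.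
  elim: k => // k IH; rewrite ltnS leq_eqVlt LS inE => /orP[/eqP ->|/IH ->].
    by rewrite eqxx.
  by rewrite orbT.
have uN j k : (j < k)%N -> u j <> u k.
  move=> /uL + E; rewrite E => uk; have [_ /=] := pickP k (L k).
  by rewrite -/(u k) uk.
exists u; split=> [j k E|k|].
- by case: (ltngtP j k) => // /uN []; rewrite E.
- by case: (pickP k (L k)) => -[].
apply/cvg_ballP => e e0; near=> k; apply: (@le_ball _ _ _ k.+1%:R^-1); last first.
  by case: (pickP k (L k)) => -[].
by apply: ltW; near: k; exact: (near_infty_natSinv_lt (PosNum e0)).
Unshelve. all: by end_near. Qed.

Lemma closed_injective_limits A : closed (injective_limits A).
Proof.
move=> x clx; apply/injective_limitsP => e e0 fin.
have e2 : 0 < e / 2 by rewrite divr_gt0.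
have [y [/injective_limitsP yA xy]] := clx _ (nbhsx_ballx x _ e2).
apply: (yA _ e2); apply: sub_finite_set fin => z [Az yz]; split=> //.
by rewrite (splitr e); exact: ball_triangle xy yz.
Qed.

End InjectiveLimits.

(** * Boxes in coordinate space *)

Section Box.
Variables (R : realType) (n : nat).
Implicit Types (u v x y : 'rV[R]_n) (A : set 'rV[R]_n) (M e a b c : R).

Definition box M u := forall i, `|u 0 i| <= M.

Lemma boxD a b u v : box a u -> box b v -> box (a + b) (u + v).
Proof. by move=> ua vb i; rewrite mxE (le_trans (ler_normD _ _)) // lerD. Qed.

Lemma boxN a u : box a u -> box a (- u).
Proof. by move=> ua i; rewrite mxE normrN. Qed.

Lemma boxZ c a b u : `|c| <= a -> box b u -> box (a * b) (c *: u).
Proof. by move=> ca ub i; rewrite mxE normrM ler_pM. Qed.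

Lemma ballE (x : 'rV[R]_n) e y : 0 < e -> (forall i, `|x 0 i - y 0 i| < e) ->
  ball x e y.
Proof. by move=> e0 H; split=> // i j; rewrite ord1 /ball /=; exact: H. Qed.

(** Pigeonhole on a grid of cubes of side [e], only finitely many of which meet the box. *)
Lemma infinite_box_close A M e : infinite_set A -> A `<=` box M -> 0 < e ->
  exists (a b : 'rV[R]_n), [/\ A a, A b, a != b & forall i, `|a 0 i - b 0 i| < e].
Proof.
move=> Ainf AM e0; pose t (a : 'rV[R]_n) i := (a 0 i + M) / e.
pose N := Num.truncn (2 * M / e).
pose f (a : 'rV[R]_n) : {ffun 'I_n -> 'I_N.+1} := [ffun i => inord (Num.truncn (t a i))].
have t0 (a : 'rV[R]_n) i : A a -> 0 <= t a i.
  move=> /AM/(_ i); rewrite ler_norml => /andP[aM _].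
  by rewrite divr_ge0 ?(ltW e0) // -lerBlDr sub0r.
have tN (a : 'rV[R]_n) i : A a -> (Num.truncn (t a i) < N.+1)%N.
  move=> Aa; rewrite ltnS le_truncn // ler_pM2r ?invr_gt0 //.
  by have := AM _ Aa i; rewrite ler_norml => /andP[_]; lra.
apply: contrapT => nex; apply: Ainf; apply: (@finite_image_inj _ _ f) finite_finset.
move=> a b /set_mem Aa /set_mem Ab fab; apply: contrapT => /eqP ab; apply: nex.
exists a, b; split=> // i.
have tab : Num.truncn (t a i) = Num.truncn (t b i).
  have := congr1 (fun h : {ffun _ -> _} => val (h i)) fab.
  by rewrite !ffunE /= !inordK ?tN.
have /andP[ta1 ta2] := truncn_itv (t0 a i Aa).
have /andP[tb1 tb2] := truncn_itv (t0 b i Ab).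
have -> : a 0 i - b 0 i = (t a i - t b i) * e.
  by rewrite /t; field; rewrite gt_eqF.
rewrite normrM (gtr0_norm e0) -[ltRHS]mul1r ltr_pM2r // ltr_norml.
by move: ta1 ta2; rewrite tab -natr1 => *; apply/andP; split; lra.
Qed.

Lemma bform_box (B : 'M[R]_n) a b u v : box a u -> box b v ->
  `|bform B u v| <= (\sum_i \sum_j `|B i j|) * (a * b).
Proof.
move=> ua vb; rewrite bform_suml (le_trans (ler_norm_sum _ _ _)) // mulr_suml.
apply: ler_sum => i _; rewrite normrM mulrCA ler_pM // {1}/bform mxE.
rewrite (le_trans (ler_norm_sum _ _ _)) // mulr_suml; apply: ler_sum => j _.
by rewrite normrM /simple_root -rowE !mxE ler_wpM2l.
Qed.

End Box.

(** * Discreteness of the root system *)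

Section Roots.
Variables (R : realType) (n : nat) (W : groupType).
Variables (m : 'I_n -> 'I_n -> option nat) (s : 'I_n -> W) (B : 'M[R]_n).
Variables (act : W -> {linear 'rV[R]_n -> 'rV[R]_n}) (o : 'rV[R]_n).
Hypothesis hWS : coxeter_system m s.
Hypothesis hB : coxeter_form m B.
Hypothesis hsign : has_signature B n.-1 1.
Hypothesis hact : geometric_action s B act.
Hypothesis ho : negative_eigenvector B o.
Implicit Types (u v x y r : 'rV[R]_n) (i j : 'I_n) (w g : W) (C e : R).
Implicit Types (Psi : set 'rV[R]_n).

Local Notation "''[' u , v ]" := (bform B u v) (format "''[' u ,  v ]").
Local Notation alpha := (@simple_root R n).
Local Notation norm1 := (norm1 o).
Local Notation root := (root_system act).

Lemma coxeter_form_sym : B^T = B.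
Proof. by case: hB. Qed.
Local Notation Bsym := coxeter_form_sym.

Lemma root_bform r : root r -> '[r, r] = 1.
Proof.
by move=> [w _ [_ [i _ <-] <-]]; rewrite (bform_act hWS hB hact) (bform_simple1 hB).
Qed.

Lemma root_act w r : root r -> root (act w r).
Proof.
move=> [g _ [_ [i _ <-] <-]]; exists (w * g)%g => //.
by exists (alpha i); [exists i|rewrite (actM hact)].
Qed.

Lemma root_reflection r : root r ->
  exists g, forall v, act g v = v - (2 * '[r, v]) *: r.
Proof.
move=> [w _ [_ [i _ <-] <-]]; exists (w * s i * w^-1)%g => v.
rewrite !(actM hact) (act_generator hact) linearB linearZ (actKV hact).
by rewrite -(bform_act hWS hB hact w) (actKV hact).
Qed.

Lemma root_eq_or_opp r r' c : root r -> root r' -> r = c *: r' ->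
  r = r' \/ r = - r'.
Proof.
move=> /root_bform rr /root_bform rr' rE; move: rr; rewrite rE !bformE rr' mulr1.
move/eqP; rewrite -expr2 sqrf_eq1 => /orP[]/eqP ->; [left|right].
  by rewrite scale1r.
by rewrite scaleN1r.
Qed.

(** The component of [r] in V_0 has square [1 - l * h ^+ 2], where [h] is the height and [l] the
    negative eigenvalue; this is bounded with [h], and [coordinate_bound] applies. *)
Lemma root_box C : exists2 M, 0 < M &
  forall r, root r -> `|norm1 r| <= C -> box M r.
Proof.
have [K K0 HK] := coordinate_bound Bsym hsign ho.
have [l l0 Hl] := bform_eigen ho.
have [C0|C0] := leP 0 C; last first.
  by exists 1 => // r _ rC; have := le_lt_trans rC C0; rewrite ltNge normr_ge0.
pose M0 := K * (1 - l * C ^+ 2).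
have M00 : 0 <= M0.
  by rewrite mulr_ge0 ?(ltW K0) // subr_ge0 (@le_trans _ _ 0) // mulr_le0_ge0 ?sqr_ge0 // ltW.
pose So := \sum_i o 0 i.
have oSo i : o 0 i <= So.
  rewrite /So (bigD1 i) //= lerDl sumr_ge0 // => j _; exact/ltW/(eigen_gt0 ho).
have So0 : 0 <= So by apply: sumr_ge0 => i _; exact/ltW/(eigen_gt0 ho).
exists (C * So + (1 + M0)); first by rewrite ltr_wpDl ?mulr_ge0 // ltr_pwDl.
move=> r rr rC i; pose h := norm1 r; pose r' := r - h *: o.
have r'1 : norm1 r' = 0 by rewrite norm1B norm1Z (norm1_eigen ho) mulr1 subrr.
have rE : r = h *: o + r' by rewrite addrC subrK.
have r'r' : '[r', r'] = 1 - l * h ^+ 2.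
  rewrite /r' !bformE (root_bform rr) (bformC Bsym r o) !Hl (norm1_eigen ho) -/h.
  by ring.
have h2 : h ^+ 2 <= C ^+ 2 by rewrite -[h ^+ 2]real_normK ?num_real // lerXn2r ?nnegrE.
have := HK r' i r'1; rewrite r'r' => b.
have {}b : r' 0 i ^+ 2 <= M0.
  apply: (le_trans b); rewrite /M0 ler_pM2l // lerD2l lerN2.
  by rewrite ler_nM2l.
(* [1 + M0] dominates the square root of [M0]. *)
have {}b : `|r' 0 i| <= 1 + M0.
  rewrite leNgt; apply/negP => bb.
  have : `|r' 0 i| ^+ 2 <= M0 by rewrite real_normK ?num_real.
  apply/negP; rewrite -ltNge; have : 0 <= M0 ^+ 2 by exact: sqr_ge0.
  by move: bb M00; set t := `|_|; nra.
rewrite {1}rE 2!mxE (le_trans (ler_normD _ _)) // lerD // normrM ler_pM //.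
by rewrite gtr0_norm ?(eigen_gt0 ho).
Qed.

(* Infinitely many roots of bounded height would contain two distinct roots [a], [b]
   so close that the product of their reflections almost fixes the simple roots;
   by [act_id] the two reflections coincide, hence [a = b] or [a = - b]. *)
Lemma finite_roots C : finite_set [set r | root r /\ `|norm1 r| <= C].
Proof.
apply: contrapT => inf; have [M M0 HM] := root_box C.
pose L := \sum_i \sum_j `|B i j|.
have L0 : 0 <= L by apply: sumr_ge0 => i _; apply: sumr_ge0.
(* [4 L M e] bounds the difference of the two reflected simple roots, and a second reflection
   multiplies bounds by at most [1 + 2 L M ^+ 2]; with [d e < 1] the coordinate 1 of the simple root
   stays positive. *)
pose d := 4 * L * M * (1 + 2 * L * M ^+ 2).
have d0 : 0 <= d by rewrite /d !mulr_ge0 ?addr_ge0 ?mulr_ge0 ?(ltW M0) ?sqr_ge0.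
pose e := (1 + d)^-1.
have e0 : 0 < e by rewrite invr_gt0 ltr_pwDl.
have de : d * e < 1 by rewrite ltr_pdivrMr ?ltr_pwDl // mul1r ltrDr.
have LMe : 4 * L * M * e < 1.
  apply: le_lt_trans de; rewrite ler_pM2r // /d -[leLHS]mulr1.
  apply: ler_wpM2l; first by rewrite !mulr_ge0 // ltW.
  by rewrite lerDl mulr_ge0 ?sqr_ge0 // mulr_ge0.
have [|a [b [[ra aC] [rb bC] ab abe]]] := infinite_box_close inf (M := M) _ e0.
  by move=> r [/HM].
have Ma := HM _ ra aC; have Mb := HM _ rb bC.
have abox : box e (a - b) by move=> i; rewrite !mxE ltW.
have [ga Ea] := root_reflection ra; have [gb Eb] := root_reflection rb.
have gg v : act ga (act ga v) = v.
  by rewrite !Ea !bformE (root_bform ra); apply/rowP => i; rewrite !mxE; ring.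
have g1 : (ga * gb)%g = 1%g.
  apply: (act_id hWS hB hact) => i.
  have box1 : box 1 (alpha i).
    by move=> j; rewrite simple_rootE; case: eqP; rewrite ?normr1 ?normr0.
  pose D := (2 * '[a, alpha i]) *: (a - b) + (2 * '[a - b, alpha i]) *: b.
  have DE : act gb (alpha i) = act ga (alpha i) + D.
    rewrite Ea Eb /D !bformE; apply/rowP => j; rewrite !mxE; ring.
  have Db : box (4 * L * M * e) D.
    have -> : 4 * L * M * e = 2 * (L * (M * 1)) * e + 2 * (L * (e * 1)) * M by ring.
    apply: boxD; apply: boxZ => //; rewrite normrM ger0_norm // ler_pM2l //.
      exact: bform_box.
    exact: bform_box.
  have DDb : box (d * e) (act ga D).
    have -> : d * e = 4 * L * M * e + 2 * (L * (M * (4 * L * M * e))) * M.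
      by rewrite /d; ring.
    rewrite Ea; apply: boxD => //; apply: boxN; apply: boxZ => //.
    by rewrite normrM ger0_norm // ler_pM2l //; exact: bform_box.
  rewrite (actM hact) DE linearD gg mxE simple_rootE eqxx /=.
  have := DDb i; rewrite ler_norml => /andP[+ _]; move: de; lra.
have : act ga (act gb a) = a by rewrite -(actM hact) g1 (act1 hact).
move/(congr1 (act ga)); rewrite gg Eb [RHS]Ea (root_bform ra) => E.
have {}E : a = '[b, a] *: b.
  apply/rowP => i; have /= := congr1 (fun x : 'rV[R]_n => x 0 i) E; rewrite !mxE; lra.
have [eab|aN] := root_eq_or_opp ra rb E; first by rewrite eab eqxx in ab.
(* If [b = - a], then [a] is half of the small vector [a - b], against ['[a, a] = 1]. *)
have : `|'[a, a]| <= L * (M * (2^-1 * e)).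
  have -> : '[a, a] = '[a, 2^-1 *: (a - b)].
    congr bform; apply/rowP => i; have -> : b = - a by rewrite aN opprK.
    by rewrite !mxE; field.
  apply: bform_box => //; apply: boxZ => //.
  by rewrite ger0_norm.
by rewrite (root_bform ra) normr1; move: LMe; lra.
Qed.

(** A normalized root has square [h ^- 2] for the height [h] of the root; rescaling to square 1
    therefore recovers the root up to sign. *)
Lemma normalize_root_finite (F : set 'rV[R]_n) : finite_set F ->
  finite_set [set r | [/\ root r, norm1 r != 0 & F (normalize o r)]].
Proof.
move=> Ff; pose f y := (Num.sqrt '[y, y])^-1 *: y.
apply: (@sub_finite_set _ _ (f @` F `|` (-%R \o f) @` F)); last first.
  by rewrite finite_setU; split; exact: finite_image.
move=> r [rr r0 Fr]; set y := normalize o r in Fr.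
have yy : '[y, y] = (norm1 r)^-1 ^+ 2.
  by rewrite !bformE (root_bform rr) mulr1 expr2.
have fy : f y = (`|norm1 r| / norm1 r) *: r.
  by rewrite /f yy sqrtr_sqr normfV invrK scalerA.
have [r1|r1] := ltP 0 (norm1 r).
  by left; exists y; rewrite // fy gtr0_norm // mulfV // scale1r.
right; exists y => //=; rewrite fy ler0_norm // mulNr mulfV //.
by rewrite scaleN1r opprK.
Qed.

Lemma normalize_root_close x C e : Qhat B o x -> 0 < e ->
  exists H, forall r, root r -> `|'[x, r]| <= C -> H < `|norm1 r| ->
    ball x e (normalize o r).
Proof.
move=> Qx e0; have [K K0 HK] := coordinate_bound Bsym hsign ho.
(* The height exceeds 1 in absolute value, so that its inverse [h] satisfies [h ^+ 2 <= |h|], and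
   exceeds [D], so that [K * |h| * (1 + 2 |C|)] falls below [e ^+ 2]. *)
pose D := K * (1 + 2 * `|C|) / e ^+ 2.
exists (1 + D) => r rr rC rH; have e2 : 0 < e ^+ 2 by rewrite exprn_gt0.
have D0 : 0 <= D.
  by rewrite mulr_ge0 ?invr_ge0 ?(ltW e2) // mulr_ge0 ?addr_ge0 ?(ltW K0).
have r1 : 1 < `|norm1 r| by apply: le_lt_trans rH; rewrite lerDl.
have r0 : norm1 r != 0 by rewrite -normr_gt0 (lt_trans _ r1).
set y := normalize o r; set h := (norm1 r)^-1.
have h1 : `|h| < 1 by rewrite normfV invf_lt1 // (lt_trans _ r1).
have y1 : norm1 (x - y) = 0.
  by case: Qx => x1 _; rewrite norm1B x1 norm1_normalize ?subrr.
have yy : '[x - y, x - y] = h ^+ 2 - 2 * h * '[x, r].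
  case: Qx => _ x0; rewrite /y /normalize -/h !bformE x0 (root_bform rr).
  by rewrite (bformC Bsym r x); ring.
have C0 : C <= `|C| by exact: ler_norm.
have yb : '[x - y, x - y] <= `|h| * (1 + 2 * `|C|).
  rewrite yy mulrDr mulr1 lerD //.
    by rewrite -[h ^+ 2]real_normK ?num_real // expr2 ger_pMl ?(ltW h1) // normr_gt0 invr_eq0.
  rewrite (le_trans (ler_norm _)) // normrN !normrM (ger0_norm (ler0n _ 2)).
  by rewrite (mulrC 2) -mulrA ler_wpM2l // ler_pM2l // (le_trans rC).
apply: ballE => // i.
have := HK _ i y1 => b.
have : (x 0 i - y 0 i) ^+ 2 < e ^+ 2.
  have -> : x 0 i - y 0 i = (x - y) 0 i by rewrite !mxE.
  apply: (le_lt_trans b); apply: (@le_lt_trans _ _ (K * (`|h| * (1 + 2 * `|C|)))).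
    by rewrite ler_pM2l.
  rewrite mulrCA normfV ltr_pdivrMl ?(lt_trans _ r1) // -ltr_pdivrMr //.
  by apply: le_lt_trans rH; rewrite lerDr.
by rewrite -[X in X < _]real_normK ?num_real // ltr_pXn2r ?nnegrE // ltW.
Qed.

(* The heights [h] of the roots [r] tend to infinity, so
   [B(r / h - x, r / h - x) = h ^- 2 - 2 B(x, r) / h] tends to [0], while [B] is
   positive definite on [V_0]. *)
Lemma infinite_roots_limit x C Psi : Qhat B o x -> infinite_set Psi ->
  (forall r, Psi r -> root r /\ `|'[x, r]| <= C) ->
  injective_limits (normalize o @` Psi) x.
Proof.
move=> Qx Pinf HP; apply/injective_limitsP => e e0 fin; apply: Pinf.
have [H HH] := normalize_root_close C Qx e0.
pose H' := Num.max 0 H.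
apply: (@sub_finite_set _ _ ([set r | root r /\ `|norm1 r| <= H'] `|`
   [set r | [/\ root r, norm1 r != 0 &
     (normalize o @` Psi `&` ball x e) (normalize o r)]])); last first.
  by rewrite finite_setU; split; [exact: finite_roots|exact: normalize_root_finite].
move=> r Pr; have [rr rC] := HP _ Pr.
have [rH|rH] := leP `|norm1 r| H'; first by left.
right; split=> //; first by rewrite -normr_gt0 (le_lt_trans _ rH) // le_max lexx.
split; first by exists r.
by apply: HH => //; apply: le_lt_trans rH; rewrite le_max lexx orbT.
Qed.

Lemma limit_roots_height (u : nat -> 'rV[R]_n) (r : nat -> 'rV[R]_n) C :
  injective u -> (forall k, root (r k)) -> (forall k, normalize o (r k) = u k) ->
  \forall k \near \oo, C < `|norm1 (r k)|.
Proof.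
move=> uI rr ru.
have : \forall k \near \oo, ~ (normalize o @` [set r | root r /\ `|norm1 r| <= C]) (u k).
  by apply: injective_leaves_finite => //; exact/finite_image/finite_roots.
apply: filterS => k; rewrite ltNge => H; apply/negP => rC; apply: H.
by exists (r k).
Qed.

End Roots.

(** * Generating subsets *)

Lemma finite_argmin (R : realDomainType) (T : choiceType) (Y : set T) (f : T -> R) (y0 : T) :
  finite_set Y -> Y y0 -> exists2 y, Y y & forall z, Y z -> f y <= f z.
Proof.
move=> /finite_seqP[l ->]; rewrite /=; elim: l y0 => // a l IH y0 _.
case: l IH => [_|b l /(_ b)].
  by exists a; rewrite /= ?inE // => z /=; rewrite inE => /eqP ->.
case=> [|y yl ymin]; first by rewrite inE eqxx.
have [ay|ya] := leP (f a) (f y).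
  exists a; first by rewrite inE eqxx.
  by move=> z; rewrite inE => /orP[/eqP -> //|/ymin]; exact: le_trans.
exists y; first by rewrite inE yl orbT.
by move=> z; rewrite inE => /orP[/eqP -> |/ymin //]; exact: ltW.
Qed.

Section Generating.
Variables (R : realType) (n : nat) (W : groupType).
Variables (m : 'I_n -> 'I_n -> option nat) (s : 'I_n -> W) (B : 'M[R]_n).
Variables (act : W -> {linear 'rV[R]_n -> 'rV[R]_n}) (o : 'rV[R]_n).
Hypothesis hWS : coxeter_system m s.
Hypothesis hB : coxeter_form m B.
Hypothesis hsign : has_signature B n.-1 1.
Hypothesis hact : geometric_action s B act.
Hypothesis ho : negative_eigenvector B o.
Implicit Types (u v x y r : 'rV[R]_n) (i j : 'I_n) (w g : W) (C e : R).
Implicit Types (I : {set 'I_n}).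

Local Notation "''[' u , v ]" := (bform B u v) (format "''[' u ,  v ]").
Local Notation alpha := (@simple_root R n).
Local Notation norm1 := (norm1 o).
Local Notation root := (root_system act).
Local Notation Bsym := (coxeter_form_sym hB).
Local Notation s2 := (coxeter_generator2 hWS).

Lemma simple_spanP I v : simple_span R I v <-> forall i, i \notin I -> v 0 i = 0.
Proof.
rewrite /simple_span /=; split=> [vI i iI|vI].
  move: vI; rewrite -[X in _ \in <<X>>%VS]in_tupleE => /coord_span ->.
  rewrite summxE big1 // => k _.
  have kI : (k < size (enum I))%N.
    by rewrite -[X in (_ < X)%N](size_map (@simple_root R n)).
  rewrite mxE (nth_map i) //.
  rewrite simple_rootE; case: eqP => [E|_]; last by rewrite mulr0.
  by move: iI; rewrite E -mem_enum mem_nth.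
rewrite (row_sum_delta v); apply: memv_suml => i _.
have [iI|/vI ->] := boolP (i \in I); last by rewrite scale0r mem0v.
by apply/memvZ/memv_span; apply/mapP; exists i; rewrite ?mem_enum.
Qed.

Lemma parabolicM I w g : parabolic s I w -> parabolic s I g ->
  parabolic s I (w * g)%g.
Proof. by case: (@subgroup_generated _ [set s i | i in [set` I]]) => _ + _; exact. Qed.

Lemma parabolicV I w : parabolic s I w -> parabolic s I w^-1%g.
Proof. by case: (@subgroup_generated _ [set s i | i in [set` I]]) => _ _; exact. Qed.

Lemma parabolic1 I : parabolic s I 1%g.
Proof. by case: (@subgroup_generated _ [set s i | i in [set` I]]). Qed.

Lemma parabolic_generator I i : i \in I -> parabolic s I (s i).
Proof. by move=> iI H [_]; apply; exists i. Qed.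

Lemma act_simple_span I w v : parabolic s I w -> simple_span R I v ->
  simple_span R I (act w v).
Proof.
move=> /(generated_word s2)[q qI ->] /simple_spanP vI; apply/simple_spanP => j jI.
elim: q qI => [|i q IH] qI; first by rewrite word_prod_nil (act1 hact) vI.
rewrite word_prod_cons (actM hact) (act_generator hact) !mxE eqxx /= IH => [|k kq].
  suff /negbTE -> : j != i by rewrite mulr0 subr0.
  by apply: contraNneq jI => ->; apply: qI; rewrite mem_head.
by apply: qI; rewrite inE kq orbT.
Qed.

(** For a generator, the product of [y] with its image is [- 2 * '[alpha i, y] ^+ 2]. When it
    vanishes [y] is fixed; otherwise it is negative and [isotropic_sheet] keeps the image in the
    same half of the cone. *)
Lemma isotropic_act w x : '[x, x] = 0 -> 0 < norm1 x -> 0 < norm1 (act w x).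
Proof.
have [q ->] := word_surj s2 (coxeter_generated hWS) w.
elim: q => [|i q IH] xx x1; first by rewrite word_prod_nil (act1 hact).
rewrite word_prod_cons (actM hact); set y := act (word_prod s q) x.
have yy : '[y, y] = 0 by rewrite (bform_act hWS hB hact).
have y1 : 0 < norm1 y by exact: IH.
have zz : '[act (s i) y, act (s i) y] = 0 by rewrite (bform_act hWS hB hact).
have yz : '[y, act (s i) y] = - 2 * '[alpha i, y] ^+ 2.
  by rewrite (act_generator hact) !bformE yy (bformC Bsym y); ring.
have [iy|iy] := eqVneq '[alpha i, y] 0.
  by rewrite (act_generator hact) iy mulr0 scale0r subr0.
apply: (isotropic_sheet Bsym hsign ho yy zz y1); last first.
  by rewrite yz mulNr oppr_lt0 mulr_gt0 // lt_neqAle eq_sym sqrf_eq0 iy sqr_ge0.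
apply: (norm1_neq0 Bsym hsign ho); rewrite ?zz //.
apply: contraTneq y1 => z0; suff -> : y = 0 by rewrite /norm1 big1 ?ltxx // => k _; rewrite mxE mulr0.
by rewrite -(actK hact (s i) y) z0 linear0.
Qed.

Lemma parabolic_roots_sub I : parabolic_roots s act I `<=` root.
Proof.
move=> _ [w _ [_ [i _ <-] <-]]; exists w => //.
by exists (alpha i); first exists i.
Qed.

Lemma parabolic_roots_span I : parabolic_roots s act I `<=` simple_span R I.
Proof.
move=> _ [w Iw [_ [i iI <-] <-]]; apply: act_simple_span => //.
apply/simple_spanP => j jI; rewrite simple_rootE; case: eqP => // ji.
by rewrite ji iI in jI.
Qed.

Lemma parabolic_roots_act I w r : parabolic s I w ->
  parabolic_roots s act I r -> parabolic_roots s act I (act w r).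
Proof.
move=> Iw [g Ig [_ [i iI <-] <-]]; exists (w * g)%g; first exact: parabolicM.
by exists (alpha i); [exists i|rewrite (actM hact)].
Qed.

Lemma parabolic_roots_simple I i : i \in I -> parabolic_roots s act I (alpha i).
Proof.
move=> iI; exists 1%g; first exact: parabolic1.
by exists (alpha i); [exists i|rewrite (act1 hact)].
Qed.

Lemma convex_hull_ge0 v :
  convex_hull (normalize o @` range alpha) v -> forall i, 0 <= v 0 i.
Proof.
pose P v := forall i, 0 <= v 0 i.
apply: (_ : convex_hull _ `<=` P); apply: smallest_sub => [x y t /set_mem Px /set_mem Py|].
  apply/mem_set => i; rewrite !mxE addr_ge0 // mulr_ge0 ?Px ?Py //.
  by rewrite subr_ge0.
move=> _ [_ [i _ <-] <-] j; rewrite mxE simple_rootE mulr_ge0 ?ler0n //.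
by rewrite norm1_simple invr_ge0 ltW // (eigen_gt0 ho).
Qed.

(* [y] is orthogonal to the simple roots of its support; a root of maximal height,
   among finitely many supported there, would have nonnegative products with these
   and be orthogonal to [y], hence be isotropic. *)
Lemma infinite_orthogonal_roots I y : '[y, y] = 0 -> simple_span R I y -> y != 0 ->
  (forall i, 0 <= y 0 i) -> (forall i, i \in I -> '[alpha i, y] <= 0) ->
  infinite_set [set r | parabolic_roots s act I r /\ '[y, r] = 0].
Proof.
move=> yy /simple_spanP yI y0 y_ge0 y_le0 fin.
have supp i : y 0 i != 0 -> i \in I by apply: contraNT => /yI ->.
have orth i : y 0 i != 0 -> '[alpha i, y] = 0.
  move=> yi; have /eqP : \sum_i - (y 0 i * '[alpha i, y]) = 0.
    by rewrite sumrN -bform_suml yy oppr0.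
  rewrite psumr_eq0 => [/allP/(_ i)|j _].
    rewrite mem_index_enum => /(_ isT); rewrite oppr_eq0 mulf_eq0 (negbTE yi).
    by move/eqP.
  have [jI|/yI ->] := boolP (j \in I); last by rewrite mul0r oppr0.
  by rewrite oppr_ge0 mulr_ge0_le0 // y_le0.
pose Th := [set r | parabolic_roots s act I r /\ forall i, y 0 i = 0 -> r 0 i = 0].
have Thy r : Th r -> '[y, r] = 0.
  move=> [_ rs]; rewrite (bformC Bsym) bform_suml big1 // => i _.
  by have [/rs ->|/orth ->] := eqVneq (y 0 i) 0; rewrite ?mul0r ?mulr0.
have Thfin : finite_set Th.
  by apply: sub_finite_set fin => r Thr; split; [case: Thr|exact: Thy].
have [i0 i0y] : exists i, y 0 i != 0.
  apply/existsP; apply: contraNT y0; rewrite negb_exists => /forallP H.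
  by apply/eqP/rowP => i; rewrite mxE; apply/eqP; have := H i; rewrite negbK.
have Th0 : Th (alpha i0).
  split; first exact/parabolic_roots_simple/supp.
  by move=> j yj; rewrite simple_rootE; case: eqP => // ji; rewrite -ji yj eqxx in i0y.
(* Height is the plain coordinate sum here; the sign turns a maximum into a minimum. *)
have [r Thr rmax] := finite_argmin (fun r => - \sum_i r 0 i) Thfin Th0.
have dom i : y 0 i != 0 -> 0 <= '[alpha i, r].
  move=> yi; have Ths : Th (act (s i) r).
    case: Thr => rI rs; split.
      apply: parabolic_roots_act => //; apply: parabolic_generator; exact: supp.
    move=> j yj; rewrite (act_generator hact) !mxE rs // eqxx /=.
    suff /negbTE -> : j != i by rewrite mulr0 subr0.
    by apply: contraNneq yi => <-; rewrite yj eqxx.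
  have := rmax _ Ths; rewrite (act_generator hact) lerN2.
  have -> : \sum_j (r - (2 * '[alpha i, r]) *: alpha i) 0 j =
      \sum_j r 0 j - 2 * '[alpha i, r].
    under eq_bigr do rewrite !mxE; rewrite big_split /= sumrN -mulr_sumr.
    rewrite [X in _ * X](bigD1 i) //= eqxx.
    by rewrite [X in _ * (_ + X)]big1 ?addr0 ?mulr1 // => j /negbTE ->.
  lra.
have r0 i : y 0 i != 0 -> '[alpha i, r] = 0.
  move=> yi; have /eqP : \sum_i y 0 i * '[alpha i, r] = 0.
    by rewrite -bform_suml Thy.
  rewrite psumr_eq0 => [/allP/(_ i)|j _].
    rewrite mem_index_enum => /(_ isT); rewrite mulf_eq0 (negbTE yi).
    by move/eqP.
  have [->|yj] := eqVneq (y 0 j) 0; first by rewrite mul0r.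
  by rewrite mulr_ge0 // dom.
have [/parabolic_roots_sub/(root_bform hWS hB hact) rr rs] := Thr.
move/eqP: rr; rewrite bform_suml big1 ?(eq_sym 0) ?oner_eq0 // => i _.
by have [/rs ->|/r0 ->] := eqVneq (y 0 i) 0; rewrite ?mul0r ?mulr0.
Qed.

Lemma generating_ge0 I v : generating B o I -> '[v, v] = 0 -> 0 < norm1 v ->
  simple_span R I v -> forall i, 0 <= v 0 i.
Proof.
move=> Ig vv v1 vI i; have v0 : norm1 v != 0 by rewrite gt_eqF.
have /Ig[/convex_hull_ge0/(_ i)] : (Qhat B o `&` simple_span R I) (normalize o v).
  split; first exact: (Qhat_normalize v0 vv).
  by apply/simple_spanP => j /((simple_spanP I v).1 vI) vj; rewrite mxE vj mulr0.
by rewrite mxE pmulr_rge0 ?invr_gt0.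
Qed.

(* Among the points of the [W_I]-orbit of [x] of height at most [1], which are
   finitely many if the conclusion fails, one of minimal height has nonpositive
   products with the simple roots of [I]. *)
Lemma generating_infinite_roots I x : generating B o I -> Qhat B o x ->
  simple_span R I x ->
  exists C, infinite_set [set r | parabolic_roots s act I r /\ `|'[x, r]| <= C].
Proof.
move=> Ig [x1 xx] xI.
pose M := \sum_i (o 0 i)^-1; pose L := \sum_i \sum_j `|B i j|.
have oV i : 0 < (o 0 i)^-1 by rewrite invr_gt0 (eigen_gt0 ho).
have M0 : 0 <= M by apply: sumr_ge0 => i _; exact: ltW.
have L0 : 0 <= L by apply: sumr_ge0 => i _; exact: sumr_ge0.
(* A point with nonnegative coordinates and height at most 1 lies in the box of size [M], and the
   simple roots lie in the box of size 1. *)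
exists (L * (M * 1)) => fin.
set Psi := [set r | _] in fin; have /finite_seqP[l Psil] := fin.
have orbit w : parabolic s I w -> [/\ '[act w x, act w x] = 0,
    simple_span R I (act w x), 0 < norm1 (act w x) & forall i, 0 <= act w x 0 i].
  move=> Iw; have ww : '[act w x, act w x] = 0 by rewrite (bform_act hWS hB hact).
  have w1 : 0 < norm1 (act w x) by apply: isotropic_act; rewrite ?x1.
  have wI : simple_span R I (act w x) by exact: act_simple_span.
  by split=> //; exact: generating_ge0 wI.
have bounded w i : parabolic s I w -> norm1 (act w x) <= 1 -> i \in I ->
    Psi (act w^-1%g (alpha i)).
  move=> Iw wx1 iI; have [_ _ _ w_ge0] := orbit w Iw; split.
    by apply: parabolic_roots_act; [exact: parabolicV|exact: parabolic_roots_simple].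
  rewrite -(bform_act hWS hB hact w) (actKV hact).
  apply: bform_box => k.
    rewrite ger0_norm //; apply: (@le_trans _ _ (o 0 k)^-1); last first.
      by rewrite /M (bigD1 k) //= lerDl sumr_ge0 // => j _; exact: ltW.
    rewrite -[leRHS]mul1r ler_pdivlMr ?(eigen_gt0 ho) // (le_trans _ wx1) //.
    rewrite /norm1 (bigD1 k) //= mulrC lerDl sumr_ge0 // => j _.
    by rewrite mulr_ge0 // ltW // (eigen_gt0 ho).
  by rewrite simple_rootE; case: eqP; rewrite ?normr1 ?normr0.
pose Y := [set act w x | w in [set w | parabolic s I w /\ norm1 (act w x) <= 1]].
(* [h] records the positions in [l] of the roots [w^-1 alpha_i] for [i] in [I]. As [w x] lies in the
   span of [I] and [x = w^-1 (w x)], this record determines [w x]. The extra slot keeps the ordinals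
   inhabited when [l] is empty. *)
pose P (h : {ffun 'I_n -> 'I_(size l).+1}) y := exists2 w,
  parabolic s I w /\ y = act w x &
  forall i, i \in I -> act w^-1%g (alpha i) = nth 0 l (h i).
have Yfin : finite_set Y.
  apply: (@sub_finite_set _ _ (range (fun h => xget 0 (P h)))); last first.
    exact/finite_image/finite_finset.
  move=> _ [w [Iw wx1] <-].
  pose h := [ffun i => inord (index (act w^-1%g (alpha i)) l)] : {ffun 'I_n -> 'I_(size l).+1}.
  have hw i : i \in I -> act w^-1%g (alpha i) = nth 0 l (h i).
    move=> iI; have := bounded w i Iw wx1 iI; rewrite Psil /= => il.
    by rewrite ffunE inordK ?nth_index // ltnS ltnW // index_mem.
  exists h => //; case: (xgetP 0 (P h)) => [y _ [w' [Iw' yE] hw']|/(_ (act w x))].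
    have [_ wI _ _] := orbit w Iw.
    suff E : act w'^-1%g (act w x) = x by rewrite yE -{1}E (actKV hact).
    rewrite -[RHS](actK hact w) (row_sum_delta (act w x)) !linear_sum.
    apply: eq_bigr => i _; rewrite !linearZ /=.
    have [iI|iI] := boolP (i \in I); first by rewrite hw // -hw'.
    by rewrite ((simple_spanP I _).1 wI i iI) !scale0r.
  by case; exists w.
have Yx : Y x.
  exists 1%g; last exact: (act1 hact).
  by split; [exact: parabolic1|rewrite (act1 hact) x1].
have [_ [w [Iw wx1] <-] wmin] := finite_argmin norm1 Yfin Yx.
have [yy yI y1 y_ge0] := orbit w Iw; set y := act w x in yy yI y1 y_ge0.
have y0 : y != 0.
  by apply: contraTneq y1 => ->; rewrite /norm1 big1 ?ltxx // => k _; rewrite mxE mulr0.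
have y_le0 i : i \in I -> '[alpha i, y] <= 0.
  move=> iI; rewrite leNgt; apply/negP => iy.
  have siy : norm1 (act (s i * w)%g x) < norm1 y.
    rewrite (actM hact) (act_generator hact) norm1B norm1Z norm1_simple -/y.
    by rewrite ltrBlDr ltrDl mulr_gt0 ?(eigen_gt0 ho) // mulr_gt0.
  have /wmin : Y (act (s i * w)%g x).
    exists (s i * w)%g => //; split; last exact: le_trans (ltW siy) wx1.
    by apply: parabolicM => //; exact: parabolic_generator.
  by rewrite leNgt siy.
apply: (infinite_orthogonal_roots yy yI y0 y_ge0 y_le0).
(* By invariance [w^-1] maps roots orthogonal to [y] to roots orthogonal to [x], all of them in
   [Psi]. *)
apply: (@finite_image_inj _ _ (act w^-1%g)).
  by move=> a b _ _ /(can_inj (actKV hact w)).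
apply: sub_finite_set fin => _ [r [rI yr] <-]; split.
  by apply: parabolic_roots_act => //; exact: parabolicV.
by rewrite -(bform_act hWS hB hact w) (actKV hact) yr normr0 !mulr_ge0.
Qed.

End Generating.

(** * Limit roots *)

Section Convex.
Variables (R : realType) (V : lmodType R).

(** The head gets weight [c a / (c a + S)] against the normalized tail; a tail of total weight
    [S = 0] cannot be normalized, but then all its terms vanish. *)
Lemma convex_combination (A : set V) (T : eqType) (l : seq T) (c : T -> R) (p : T -> V) :
  convex_set A -> (forall i, 0 <= c i) -> (forall i, A (p i)) ->
  0 < \sum_(i <- l) c i ->
  A ((\sum_(i <- l) c i)^-1 *: \sum_(i <- l) c i *: p i).
Proof.
move=> cA c0 pA; elim: l => [|a l IH]; first by rewrite big_nil ltxx.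
rewrite !big_cons; set S := \sum_(j <- l) c j; set q := \sum_(j <- l) _.
have S0 : 0 <= S by exact: sumr_ge0.
have [Sz|Sn] := eqVneq S 0.
  have -> : q = 0.
    rewrite /q big_seq big1 // => i il; have /eqP := Sz.
    by rewrite /S psumr_eq0 // => /allP/(_ i il)/eqP ->; rewrite scale0r.
  rewrite Sz !addr0 => ca; rewrite scalerA mulVf ?scale1r //.
  by rewrite gt_eqF.
have {}S0 : 0 < S by rewrite lt_neqAle eq_sym Sn.
move=> caS; have t0 : 0 <= c a / (c a + S) by rewrite divr_ge0 // ltW.
have t1 : c a / (c a + S) <= 1 by rewrite ler_pdivrMr // mul1r lerDl ltW.
have := cA _ _ (Itv01 t0 t1) (mem_set (pA a)) (mem_set (IH S0)).
move=> /set_mem; congr (A _); rewrite /conv /= scalerDr !scalerA; congr (_ + _).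
  by rewrite mulrC.
congr (_ *: _); rewrite /unstable.onem -/S; field.
by rewrite Sn gt_eqF.
Qed.

End Convex.

(** * Continuity of the form and of the normalization *)

Section Continuity.
Variables (R : realType) (n : nat) (B : 'M[R]_n) (o : 'rV[R]_n).
Variables (T : Type) (F : set_system T).
Hypothesis FF : Filter F.
Implicit Types (f g : T -> 'rV[R]_n) (x y : 'rV[R]_n).

Lemma cvg_coord f x i : f @ F --> x -> f t 0 i @[t --> F] --> x 0 i.
Proof.
move=> fx; apply: (@continuous_cvg T _ _ F FF f (fun M : 'rV[R]_n => M 0 i) x) fx.
exact: coord_continuous.
Qed.

Lemma cvg_norm1 f x : f @ F --> x -> norm1 o (f t) @[t --> F] --> norm1 o x.
Proof.
move=> fx; apply: cvg_big => [|i _]; first exact: add_continuous.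
by apply: cvgM; [exact: cvg_cst|exact: cvg_coord].
Qed.

Lemma cvg_bform f g x y : f @ F --> x -> g @ F --> y ->
  bform B (f t) (g t) @[t --> F] --> bform B x y.
Proof.
move=> fx gy; rewrite bform_suml; under eq_cvg do rewrite bform_suml.
apply: cvg_big => [|i _]; first exact: add_continuous.
apply: cvgM; first exact: cvg_coord.
rewrite /bform mxE; under eq_cvg do rewrite mxE.
apply: cvg_big => [|j _]; first exact: add_continuous.
apply: cvgM; first exact: cvg_cst.
by rewrite mxE; under eq_cvg do rewrite mxE; exact: cvg_coord.
Qed.

Lemma cvg_normalize f x : norm1 o x != 0 -> f @ F --> x ->
  normalize o (f t) @[t --> F] --> normalize o x.
Proof.
by move=> x0 fx; apply: cvgZ => //; apply: cvgV => //; exact: cvg_norm1.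
Qed.

End Continuity.

(** * Limit roots and the closure of [F0] *)

Section LimitRoots.
Variables (R : realType) (n : nat) (W : groupType).
Variables (m : 'I_n -> 'I_n -> option nat) (s : 'I_n -> W) (B : 'M[R]_n).
Variables (act : W -> {linear 'rV[R]_n -> 'rV[R]_n}) (o : 'rV[R]_n).
Hypothesis hWS : coxeter_system m s.
Hypothesis hB : coxeter_form m B.
Hypothesis hsign : has_signature B n.-1 1.
Hypothesis hact : geometric_action s B act.
Hypothesis ho : negative_eigenvector B o.
Implicit Types (u v x y r : 'rV[R]_n) (i j : 'I_n) (w g : W) (C e : R).
Implicit Types (I : {set 'I_n}).

Local Notation "''[' u , v ]" := (bform B u v) (format "''[' u ,  v ]").
Local Notation alpha := (@simple_root R n).
Local Notation norm1 := (norm1 o).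
Local Notation root := (root_system act).
Local Notation Bsym := (coxeter_form_sym hB).

Lemma injective_limits_sub (T : topologicalType) (A A' : set T) : A `<=` A' ->
  injective_limits A `<=` injective_limits A'.
Proof. by move=> AA' x [u [uI uA ux]]; exists u; split=> // k; exact/AA'/uA. Qed.

Lemma limit_rootsP x : limit_roots act o x ->
  exists u : nat -> 'rV[R]_n, exists r : nat -> 'rV[R]_n,
  [/\ u @ \oo --> x, forall k, root (r k), forall k, normalize o (r k) = u k &
    forall C, \forall k \near \oo, C < `|norm1 (r k)|].
Proof.
move=> [u [uI uA ux]].
have /choice[r ru] : forall k, exists z, root z /\ normalize o z = u k.
  by move=> k; case: (uA k) => z rz zu; exists z; split.
have r_root k : root (r k) by case: (ru k).
have r_u k : normalize o (r k) = u k by case: (ru k).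
by exists u, r; split=> // C; exact: (limit_roots_height hWS hB hsign hact ho _ uI r_root r_u).
Qed.

(** The normalized root of height [h] has square [h ^- 2], and the heights tend to infinity in
    absolute value. *)
Lemma limit_roots_Qhat x : limit_roots act o x -> Qhat B o x.
Proof.
move=> /limit_rootsP[u [r [ux rr ru rC]]]; split.
  apply: (@cvg_unique _ (@Rhausdorff R) (norm1 (u k) @[k --> \oo])).
    exact: cvg_norm1.
  apply: cvg_near_cst; near=> k; rewrite -ru norm1_normalize // -normr_gt0.
  by near: k; exact: rC.
apply: (@cvg_unique _ (@Rhausdorff R) ('[u k, u k] @[k --> \oo])).
  exact: cvg_bform.
apply/cvgrPdist_lt => e e0; near=> k.
(* A height beyond [1 + e^-1] has a square beyond [e^-1]. *)
have k1 : 1 + e^-1 < `|norm1 (r k)| by near: k; exact: rC.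
have e1 : 0 < e^-1 by rewrite invr_gt0.
have k0 : 0 < `|norm1 (r k)| by apply: lt_trans k1; rewrite addr_gt0.
rewrite sub0r normrN -ru !bformE (root_bform hWS hB hact) // mulr1 -invfM normfV.
rewrite invf_plt ?posrE ?normrM ?mulr_gt0 //.
apply: (@lt_trans _ _ `|norm1 (r k)|).
  by apply: lt_trans k1; rewrite ltrDr.
by rewrite ltr_pMr //; apply: lt_trans k1; rewrite ltrDl.
Unshelve. all: by end_near. Qed.

Lemma parabolic_limit_roots_sub I : parabolic_limit_roots s act o I `<=`
  Qhat B o `&` simple_span R I.
Proof.
move=> x xI; split.
  apply: limit_roots_Qhat; apply: injective_limits_sub xI.
  by apply: image_subset; exact: parabolic_roots_sub.
case: xI => u [_ uA ux]; apply/simple_spanP => i iI.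
apply: (@cvg_unique _ (@Rhausdorff R) (u k 0 i @[k --> \oo])).
  exact: cvg_coord.
apply: cvg_near_cst; near=> k; have [r rI <-] := uA k.
have /simple_spanP := parabolic_roots_span hWS hact rI.
by rewrite mxE => ->; rewrite ?mulr0.
Unshelve. all: by end_near. Qed.

Lemma generating_limit_roots I : generating B o I ->
  parabolic_limit_roots s act o I = Qhat B o `&` simple_span R I.
Proof.
move=> Ig; apply/seteqP; split; first exact: parabolic_limit_roots_sub.
move=> x [Qx xI].
have [C inf] := generating_infinite_roots hWS hB hsign hact ho Ig Qx xI.
apply: (injective_limits_sub (@image_subset _ _ (normalize o) _ _ _)); last first.
  apply: (infinite_roots_limit hWS hB hsign hact ho Qx inf) => r [rI rC].
  by split; [exact: (@parabolic_roots_sub _ _ _ s act I r rI)|exact: rC].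
by move=> r [].
Qed.

(** The group element is applied to the roots instead of the limit: by invariance, [w] carries roots
    of bounded product with [x] to roots of bounded product with the image of [x]. *)
Lemma generating_roots_limit I w x : generating B o I ->
  (Qhat B o `&` simple_span R I) x ->
  limit_roots act o (normalize o (act w x)).
Proof.
move=> Ig [Qx xI].
have [C inf] := generating_infinite_roots hWS hB hsign hact ho Ig Qx xI.
have w1 : 0 < norm1 (act w x).
  by case: Qx => x1 xx; apply: (isotropic_act hWS hB hsign hact ho); rewrite ?x1.
have w0 : norm1 (act w x) != 0 by rewrite gt_eqF.
have Qw : Qhat B o (normalize o (act w x)).
  by apply: Qhat_normalize => //; rewrite (bform_act hWS hB hact); case: Qx.
pose Psi := act w @` [set r | parabolic_roots s act I r /\ `|'[x, r]| <= C].
have Pinf : infinite_set Psi.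
  move=> fin; apply: inf; apply: (finite_image_inj _ fin).
  by move=> a b _ _ /(can_inj (actK hact w)).
have Psi_root : Psi `<=` root.
  by move=> _ [r [/parabolic_roots_sub rr _] <-]; exact: (root_act hact).
apply: (injective_limits_sub (@image_subset _ _ (normalize o) _ _ Psi_root)).
apply: (infinite_roots_limit hWS hB hsign hact ho (C := (norm1 (act w x))^-1 * C) Qw Pinf).
move=> r Pr; split; first exact: Psi_root.
case: Pr => z [_ zC] <-; rewrite bformZl (bform_act hWS hB hact) normrM.
by rewrite gtr0_norm ?invr_gt0 // ler_pM2l ?invr_gt0.
Qed.

Lemma closure_F0_sub : closure (F0 act B o) `<=` limit_roots act o.
Proof.
rewrite [X in _ `<=` X](closure_id _).1; last exact: closed_injective_limits.
apply: closureS => _ [w _ [x [I Ig xI] <-]].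
exact: generating_roots_limit xI.
Qed.

Lemma F0_Qhat x : F0 act B o x -> Qhat B o x.
Proof.
by move=> [w _ [z [I Ig zI] <-]]; apply: limit_roots_Qhat; exact: generating_roots_limit Ig zI.
Qed.

Lemma F0_act w x : F0 act B o x -> F0 act B o (normalize o (act w x)).
Proof.
move=> [g _ [z zG <-]]; exists (w * g)%g => //; exists z => //.
have g1 : norm1 (act g z) != 0.
  case: zG => I _ [[z1 zz] _]; rewrite gt_eqF //.
  by apply: (isotropic_act hWS hB hsign hact ho); rewrite ?z1.
by rewrite linearZ /= normalizeZ ?invr_eq0 // (actM hact).
Qed.

(* Writing [u = r / h] for the normalized root of height [h], one has
   [h ^- 2 = B(u, u)], so the normalized reflection of [x] in [r] is the
   normalization of [B(u, u) x - 2 B(u, x) u], which tends to [y] as [u] does. *)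
Lemma limit_roots_closure_F0 x y : F0 act B o x -> limit_roots act o y ->
  closure (F0 act B o) y.
Proof.
move=> F0x Ey; have Qx := F0_Qhat F0x; have Qy := limit_roots_Qhat Ey.
have [->|xy] := eqVneq y x; first exact: subset_closure.
have [u [r [ux rr ru rC]]] := limit_rootsP Ey.
(* This makes [f y] a nonzero multiple of [y], so that normalization is continuous there. *)
have yx : '[y, x] != 0 by rewrite lt_eqF // (Qhat_lt0 Bsym hsign ho).
pose f v := '[v, v] *: x - (2 * '[v, x]) *: v.
have fy : f y = (- (2 * '[y, x])) *: y.
  by case: Qy => _ yy; rewrite /f yy scale0r sub0r scaleNr.
have c0 : - (2 * '[y, x]) != 0 by rewrite oppr_eq0 mulf_neq0.
have nfy : normalize o (f y) = y.
  rewrite fy normalizeZ // /normalize.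
  by case: Qy => -> _; rewrite invr1 scale1r.
have fu : normalize o (f (u k)) @[k --> \oo] --> y.
  rewrite -[X in _ --> X]nfy; apply: cvg_normalize.
    by rewrite fy norm1Z; case: Qy => -> _; rewrite mulr1.
  apply: cvgB; first by apply: cvgZ; [exact: cvg_bform|exact: cvg_cst].
  apply: cvgZ => //; apply: cvgM; first exact: cvg_cst.
  by apply: cvg_bform => //; exact: cvg_cst.
apply: (@closed_cvg _ _ \oo _ (fun k => normalize o (f (u k)))
  (closure (F0 act B o)) (@closed_closure _ _) _ _ fu); near=> k.
have k0 : norm1 (r k) != 0 by rewrite -normr_gt0; near: k; exact: rC.
apply: subset_closure; have [g gE] := root_reflection hWS hB hact (rr k).
suff -> : normalize o (f (u k)) = normalize o (act g x) by exact: F0_act.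
rewrite -(normalizeZ o (act g x) (_ : (norm1 (r k))^-1 ^+ 2 != 0)); last first.
  by rewrite expf_neq0 // invr_eq0.
congr (normalize o _); rewrite gE /f -ru !bformE (root_bform hWS hB hact) //.
by apply/rowP => i; rewrite !mxE; ring.
Unshelve. all: by end_near. Qed.

Lemma coxeter_form_le0 i j : i != j -> B i j <= 0.
Proof.
move=> ij; case E : (m i j) => [k|].
  have k1 : (1 < k)%N by case: hWS => -[_ _ /(_ _ _ _ ij E)].
  case: hB => _ _ /(_ _ _ _ ij E) -> _; rewrite oppr_le0.
  apply: cos_ge0_pihalf; apply/andP; split.
    rewrite (@le_trans _ _ 0) ?oppr_le0 ?divr_ge0 ?pi_ge0 //.
  by rewrite ler_pM2l ?pi_gt0 // lef_pV2 ?posrE ?ltr0n ?ler_nat //; exact: ltnW.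
by case: hB => _ _ _ /(_ _ _ E) /le_trans; apply; rewrite lerN10.
Qed.

(** [x] is the combination of the normalized simple roots with weights [o_i x_i], whose sum is
    [norm1 x = 1]. *)
Lemma ge0_generating I :
  (forall x, Qhat B o x -> simple_span R I x -> forall i, 0 <= x 0 i) ->
  generating B o I.
Proof.
move=> H x [Qx xI]; split=> // A [cA oA].
have x_ge0 := H x Qx xI; have [x1 _] := Qx.
pose p i := normalize o (alpha i).
have pA i : A (p i) by apply: oA; exists (alpha i); first exists i.
have := @convex_combination _ _ A _ (index_enum 'I_n) (fun i => o 0 i * x 0 i) p cA.
rewrite -/(norm1 x) x1 invr1 scale1r.
have -> : \sum_i (o 0 i * x 0 i) *: p i = x.
  rewrite [RHS]row_sum_delta; apply: eq_bigr => i _.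
  rewrite /p /normalize norm1_simple scalerA; congr (_ *: _).
  by field; rewrite gt_eqF // (eigen_gt0 ho).
by apply => // i; rewrite mulr_ge0 // ltW // (eigen_gt0 ho).
Qed.

(* A subset minimal among those whose span contains an isotropic or negative
   vector is generating: the positive and negative parts of [x] would otherwise lie
   in positive definite spans, and their product is nonpositive. *)
Lemma F0_neq0 : exists x, F0 act B o x.
Proof.
pose P I := `[< exists v, [/\ v != 0, simple_span R I v & '[v, v] <= 0] >].
have o0 : o != 0.
  apply/eqP => o0; have := norm1_eigen ho; rewrite o0 /Defs.norm1 big1 => [/esym/eqP|i _].
    by rewrite oner_eq0.
  by rewrite mxE mul0r.
have PT : P [set: 'I_n]%SET.
  apply/asboolP; exists o; split=> //; first by apply/simple_spanP => i; rewrite inE.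
  by rewrite ltW // (bform_eigen_lt0 ho).
have [I /asboolP[v [v0 vI vv]] Imin] := arg_minnP (fun I : {set 'I_n} => #|I|) PT.
(* A vector vanishing at [i] lies in the span of [I] without [i]; minimality of [I] makes its square
   positive. *)
have Idef i u : i \in I -> simple_span R I u -> u 0 i = 0 -> u != 0 -> 0 < '[u, u].
  move=> iI /simple_spanP uI ui u0; rewrite ltNge; apply/negP => uu.
  have /Imin : P (I :\ i)%SET.
    apply/asboolP; exists u; split=> //; apply/simple_spanP => j.
    by rewrite !inE negb_and negbK => /orP[/eqP ->|/uI].
  by rewrite leqNgt (cardsD1 i I) iI ltnS leqnn.
have gen : generating B o I.
  apply: ge0_generating => x [x1 xx] /simple_spanP xI i; rewrite leNgt; apply/negP => xi.
  have iI : i \in I by apply: contraTT xi => /xI ->; rewrite ltxx.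
  have [j xj] : exists j, 0 < x 0 j.
    apply/existsP; apply: contraTT (@ltr01 R); rewrite negb_exists -leNgt => /forallP H.
    rewrite -x1 /norm1 sumr_le0 // => j _; rewrite mulr_ge0_le0 //.
      by rewrite ltW // (eigen_gt0 ho).
    by rewrite leNgt H.
  have jI : j \in I by apply: contraTT xj => /xI ->; rewrite ltxx.
  (* The coordinate at [i] vanishes in [xp] and that at [j] in [xm], so [Idef] applies to both. *)
  pose xp : 'rV[R]_n := \row_k Num.max (x 0 k) 0.
  pose xm : 'rV[R]_n := \row_k Num.max (- x 0 k) 0.
  have xpI : simple_span R I xp.
    by apply/simple_spanP => k /xI xk; rewrite mxE xk maxxx.
  have xmI : simple_span R I xm.
    by apply/simple_spanP => k /xI xk; rewrite mxE xk oppr0 maxxx.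
  have xE : x = xp - xm.
    apply/rowP => k; rewrite !mxE; case: (leP 0 (x 0 k)) => xk.
      by rewrite max_r ?subr0 // oppr_le0.
    by rewrite max_l ?sub0r ?opprK // oppr_ge0 ltW.
  have xpm : '[xp, xm] <= 0.
    rewrite bform_suml; apply: sumr_le0 => k _; rewrite (bformC Bsym) bform_suml mulr_sumr.
    apply: sumr_le0 => h _; rewrite bform_simple mulrA; have [hk|hk] := eqVneq h k.
      rewrite hk !mxE; case: (leP 0 (x 0 k)) => xk.
        by rewrite (max_r (_ : - x 0 k <= 0)) ?oppr_le0 // mulr0 mul0r.
      by rewrite !mul0r.
    by rewrite mulr_ge0_le0 ?coxeter_form_le0 // mulr_ge0 // mxE le_max lexx orbT.
  have xpp : 0 < '[xp, xp].
    apply: (Idef i) => //; first by rewrite mxE max_r // ltW.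
    apply: contraTneq xj => /(congr1 (fun u : 'rV[R]_n => u 0 j)).
    by rewrite !mxE -leNgt => <-; rewrite le_max lexx.
  have xmm : 0 < '[xm, xm].
    apply: (Idef j) => //; first by rewrite mxE max_r // oppr_le0 ltW.
    apply: contraTneq xi => /(congr1 (fun u : 'rV[R]_n => u 0 i)).
    by rewrite !mxE -leNgt -oppr_le0 => <-; rewrite le_max lexx.
  move: xx; rewrite xE !bformE (bformC Bsym xm xp); lra.
suff [x [x0 xI xx]] : exists x, [/\ x != 0, simple_span R I x & '[x, x] = 0].
  have x1 : norm1 x != 0 by apply: (norm1_neq0 Bsym hsign ho); rewrite ?xx.
  have xG : (Qhat B o `&` simple_span R I) (normalize o x).
    split; first exact: Qhat_normalize.
    apply/simple_spanP => k kI.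
    by rewrite mxE ((simple_spanP I x).1 xI k kI) mulr0.
  by exists (normalize o (act 1%g (normalize o x))), 1%g => //; exists (normalize o x) => //; exists I.
move: vI => /simple_spanP vI.
have [i iI] : exists i, i \in I.
  apply/existsP; apply: contraNT v0; rewrite negb_exists => /forallP H.
  by apply/eqP/rowP => i; rewrite mxE vI.
(* [d - b] is a root in [t] of [t ^+ 2 + 2 b t + '[v, v]], the square of [v + t alpha_i]; it is real
   because ['[v, v] <= 0]. *)
pose b := '[v, alpha i]; pose d := Num.sqrt (b ^+ 2 - '[v, v]).
have d2 : d ^+ 2 = b ^+ 2 - '[v, v].
  by rewrite sqr_sqrtr // subr_ge0 (le_trans vv) // sqr_ge0.
have tt : '[v + (d - b) *: alpha i, v + (d - b) *: alpha i] = 0.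
  rewrite !bformE (bformC Bsym (alpha i) v) (bform_simple1 hB) -/b mulr1.
  transitivity ('[v, v] + d ^+ 2 - b ^+ 2); first by ring.
  by rewrite d2; ring.
have [vz|vz] := eqVneq '[v, v] 0; first by exists v; split=> //; exact/simple_spanP.
exists (v + (d - b) *: alpha i); split=> //.
  (* If this vector were zero, [v] would be a multiple of [alpha i], of nonnegative square. *)
  apply: contraNneq vz => /eqP; rewrite addr_eq0 => /eqP vE.
  rewrite eq_le vv /=; suff -> : '[v, v] = (d - b) ^+ 2 by exact: sqr_ge0.
  by rewrite {1 2}vE !bformE (bform_simple1 hB); ring.
apply/simple_spanP => k kI; rewrite mxE vI // add0r mxE simple_rootE.
by case: eqP => [ki|_]; rewrite ?mulr0 //; rewrite ki iI in kI.
Qed.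

End LimitRoots.


Unset Implicit Arguments.

Theorem mainTheorem3 (R : realType) (n : nat) (W : groupType)
    (m : 'I_n -> 'I_n -> option nat) (s : 'I_n -> W) (B : 'M[R]_n)
    (act : W -> {linear 'rV[R]_n -> 'rV[R]_n}) (o : 'rV[R]_n)
    (hWS : coxeter_system m s) (hirr : irreducible_coxeter m)
    (hB : coxeter_form m B) (hsign : has_signature B n.-1 1)
    (hact : geometric_action s B act) (ho : negative_eigenvector B o) :
  (forall I : {set 'I_n}, generating B o I ->
     parabolic_limit_roots s act o I = Qhat B o `&` simple_span R I) /\
  limit_roots act o = closure (F0 act B o).
Proof.
split=> [I Ig|]; first exact: (generating_limit_roots hWS hB hsign hact ho).
apply/seteqP; split=> [x Ex|]; last exact: (@closure_F0_sub _ _ _ _ _ _ _ _ hWS hB hsign hact ho).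
(* A point of [F0] to be reflected in the roots that converge to [x]. *)
have [e F0e] := @F0_neq0 _ _ _ _ _ _ act _ hWS hB hsign ho.
exact: (limit_roots_closure_F0 hWS hB hsign hact ho F0e Ex).
Qed.
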